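(* (a) Let $\alpha\in\mathbb{R}^2$ be an irrational vector. Any convex, centrally symmetric polygon in $\mathbb{R}^2$ with vertices belonging to $\mathbb{Z}\alpha+\mathbb{Z}^2$ is a bounded remainder set (with respect to $\alpha$). (b) More generally, let $d \geq 1$ and let $\alpha\in\mathbb{R}^d$ be an irrational vector. Any zonotope in $\mathbb{R}^d$ with vertices belonging to $\mathbb{Z}\alpha+\mathbb{Z}^d$ is a bounded remainder set (with respect to $\alpha$).
   Context: A vector $\alpha = (\alpha_1,\dots,\alpha_d) \in \mathbb{R}^d$ is called irrational if $1, \alpha_1, \ldots, \alpha_d$ are linearly independent over $\mathbb{Q}$. We write $\mathbb{Z}\alpha+\mathbb{Z}^d = \{ n\alpha + m : n \in \mathbb{Z}, m \in \mathbb{Z}^d\}$ and $\mathbb{T}^d = \mathbb{R}^d/\mathbb{Z}^d$. For a bounded measurable set $S \subset \mathbb{R}^d$ let $\chi_S(x) = \sum_{k \in \mathbb{Z}^d} \mathbf{1}_S(x+k)$, a $\mathbb{Z}^d$-periodic function regarded as a function on $\mathbb{T}^d$. A bounded measurable set $S \subset \mathbb{R}^d$ is a bounded remainder set (BRS) with respect to $\alpha$ if there is a constant $C = C(S,\alpha)$ such that for every $n \geq 1$ and almost every $x \in \mathbb{T}^d$, $\left| \sum_{k=0}^{n-1} \chi_S(x+k\alpha) - n \operatorname{mes} S \right| \leq C$, where $\operatorname{mes}$ is Lebesgue measure. A zonotope is a convex polytope which can be represented as the Minkowski sum of several (finitely many) line segments. *)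

(* Defs.v *)
From HB Require Import structures.
From mathcomp Require Import all_boot all_order all_algebra.
From mathcomp Require Import all_classical all_reals all_analysis.

Set Implicit Arguments.
Unset Strict Implicit.
Unset Printing Implicit Defensive.

Import Order.TTheory GRing.Theory Num.Theory.
Import numFieldNormedType.Exports.

Local Open Scope classical_set_scope.
Local Open Scope ring_scope.

Section convex_geometry.
Context (R : realType) (E : lmodType R).
Implicit Types S X : set E.

Definition convex_hull X : set E := smallest (@convex_set R E) X.

Definition convex_polytope S :=
  exists2 X, finite_set X & S = convex_hull X.

(* The vertices of a convex polytope are its extreme points. *)
Definition vertices S : set E :=
  [set v | S v /\ forall x y (t : R), S x -> S y -> 0 < t -> t < 1 ->
    v = t *: x + (1 - t) *: y -> x = v /\ y = v].

Definition segment (a b : E) : set E :=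
  [set (1 - t) *: a + t *: b | t in `[0, 1]].

Definition minkowski_sum (m : nat) (A : 'I_m -> set E) : set E :=
  [set \sum_(i < m) s i | s in [set s : 'I_m -> E | forall i, A i (s i)]].

Definition zonotope S := convex_polytope S /\
  exists (m : nat) (a b : 'I_m -> E),
    S = minkowski_sum (fun i => segment (a i) (b i)).

Definition centrally_symmetric S :=
  exists c : E, forall x, S x -> S (c *+ 2 - x).

End convex_geometry.

(* A polygon is two-dimensional: points and segments are excluded. *)
Definition convex_polygon (R : realType) (S : set 'rV[R]_2) :=
  convex_polytope S /\ S° !=set0.

Definition intv (R : realType) d (m : 'rV[int]_d) : 'rV[R]_d :=
  map_mx intr m.

Definition irrational_vector (R : realType) d (alpha : 'rV[R]_d) :=
  forall (q0 : rat) (q : 'I_d -> rat),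
    ratr q0 + \sum_(i < d) ratr (q i) * alpha 0 i = 0 ->
    q0 = 0 /\ forall i, q i = 0.

Definition rotation_group (R : realType) d (alpha : 'rV[R]_d) : set 'rV[R]_d :=
  [set x | exists (n : int) (m : 'rV[int]_d), x = n%:~R *: alpha + intv R m].

(** Lebesgue measure on R^(d+1): the outer measure generated by the volume of
    half-open boxes, restricted to its Caratheodory measurable sets.  In
    dimension 0 the formula would give an infinite value to the empty set, hence
    the successor in the dimension. *)

Section lebesgue.
Context (R : realType) (d : nat).
Local Notation V := 'rV[R]_d.+1.
Local Open Scope ereal_scope.

Definition box (a b : V) : set V :=
  [set x | forall i, (a 0 i < x 0 i <= b 0 i)%R].

Definition box_volume (a b : V) : R :=
  (\prod_(i < d.+1) Num.max 0 (b 0 i - a 0 i))%R.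

Definition box_cover (A : set V) : set (nat -> V * V) :=
  [set B | A `<=` \bigcup_k box (B k).1 (B k).2].

Definition lebesgue_outer (A : set V) : \bar R :=
  ereal_inf [set \sum_(k <oo) (box_volume (B k).1 (B k).2)%:E
            | B in box_cover A].

Local Notation bvol := (fun p : V * V => (box_volume p.1 p.2)%:E).

Lemma box_volume_ge0 a b : (0 <= box_volume a b)%R.
Proof. by rewrite prodr_ge0// => i _; rewrite le_max lexx. Qed.

Lemma le_lebesgue_outer : {homo lebesgue_outer : A B / A `<=` B >-> A <= B}.
Proof.
move=> A B AB; apply/ereal_inf_le_tmp => x [F FB <-].
by exists F => //; exact: subset_trans FB.
Qed.

Lemma lebesgue_outer_ge0 A : 0 <= lebesgue_outer A.
Proof.
by apply: le_ereal_inf_tmp => x [B AB <-]; apply: nneseries_ge0 => n _ _;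
  rewrite lee_fin box_volume_ge0.
Qed.

Lemma lebesgue_outer0 : lebesgue_outer set0 = 0.
Proof.
apply/eqP; rewrite eq_le lebesgue_outer_ge0 andbT.
apply: ereal_inf_lbound; exists (fun=> (0, 0)%R) => //.
apply: eseries0 => n _ _ /=.
by rewrite /box_volume big_ord_recl mxE subrr maxxx mul0r.
Qed.

Lemma lebesgue_outer_sigma_subadditive : sigma_subadditive lebesgue_outer.
Proof.
move=> A; have [[i ioo]|] := pselect (exists i, lebesgue_outer (A i) = +oo).
  rewrite (eseries_pinfty _ _ ioo) ?leey// => n _.
  by rewrite -ltNye (lt_le_trans _ (lebesgue_outer_ge0 _)).
rewrite -forallNE => Aoo.
suff add2e (e : {posnum R}) : lebesgue_outer (\bigcup_n A n) <=
    \sum_(i <oo) lebesgue_outer (A i) + e%:num%:E.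
  by apply/lee_addgt0Pr => _/posnumP[].
rewrite (le_trans _ (epsilon_trick _ _ _))//; last first.
  by move=> n; exact: lebesgue_outer_ge0.
pose P n (B : nat -> V * V) := box_cover (A n) B /\
  \sum_(k <oo) bvol (B k) <=
    lebesgue_outer (A n) + (e%:num / (2 ^ n.+1)%:R)%:E.
have [G PG] : {G : nat -> nat -> V * V & forall n, P n (G n)}.
  apply: (@choice _ _ P) => n.
  have fn : lebesgue_outer (A n) \is a fin_num.
    by rewrite ge0_fin_numE ?lebesgue_outer_ge0// ltey; apply/eqP; exact: Aoo.
  have en1 : (0 < e%:num / (2 ^ n.+1)%:R)%R by [].
  have [x [B AB <-] xS] := lb_ereal_inf_adherent en1 fn.
  by exists B; split => //; exact/ltW.
pose u := bvol \o uncurry G.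
have u_ge0 x : 0 <= u x by rewrite lee_fin box_volume_ge0.
apply: (@le_trans _ _ (\esum_(i in setT) u i)).
  apply: ereal_inf_lbound => /=.
  have /card_esym/ppcard_eqP[f] := card_nat2.
  exists (uncurry G \o f).
    move=> t [i _ /((PG i).1)[j _ Gt]]; exists (f^-1%FUN (i, j)) => //=.
    by rewrite invK ?inE.
  rewrite -(esum_pred_image u _ xpredT) ?[fun=> _]set_true//.
  by rewrite image_eq.
rewrite (_ : esum _ _ = \sum_(i <oo) \sum_(j <oo ) bvol (G i j)); last first.
  pose J : nat -> set (nat * nat) := fun i => [set (i, j) | j in setT].
  rewrite (_ : setT = \bigcup_k J k); last first.
    by rewrite predeqE => -[a b]; split => // _; exists a => //; exists b.
  rewrite esum_bigcupT /=; last 2 first.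
    - apply/trivIsetP => i j _ _ ij.
      rewrite predeqE => -[n m] /=; split => //= -[] [_] _ [<-{n} _].
      by move=> [m' _] [] /esym/eqP; rewrite (negbTE ij).
    - by move=> /= [n m]; exact: u_ge0.
  rewrite -(image_id [set: nat]) -fun_true esum_pred_image//; last first.
    by move=> n _; exact: esum_ge0.
  apply: eq_eseriesr => /= j _.
  rewrite -(esum_pred_image u (pair j) predT)//=; last first.
    by move=> ? ? _ _; exact: (@can_inj _ _ _ snd).
  by congr esum; rewrite predeqE => -[a b]; split; move=> [i _ <-]; exists i.
apply: lee_lim.
- apply: is_cvg_nneseries => n *.
  by apply: nneseries_ge0 => m *; exact: (u_ge0 (n, m)).
- by apply: is_cvg_nneseries => n *; rewrite adde_ge0 ?lebesgue_outer_ge0.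
- by near=> n; apply: lee_sum => i _; exact: (PG i).2.
Unshelve. all: by end_near. Qed.

HB.instance Definition _ := isOuterMeasure.Build R V lebesgue_outer
  lebesgue_outer0 lebesgue_outer_ge0 le_lebesgue_outer
  lebesgue_outer_sigma_subadditive.

Definition mes : set (caratheodory_type lebesgue_outer) -> \bar R := lebesgue_outer.

Lemma mes_semi_sigma_additive : semi_sigma_additive mes.
Proof.
move=> F mF tF mUF; rewrite /mes.
exact: caratheodory_measure_sigma_additive.
Qed.

HB.instance Definition _ := isMeasure.Build _ _ _ mes
  lebesgue_outer0 lebesgue_outer_ge0 mes_semi_sigma_additive.

End lebesgue.
Arguments mes {R d}.

Section bounded_remainder_set.
Context (R : realType) (d : nat).
Implicit Types (S : set 'rV[R]_d.+1) (x alpha : 'rV[R]_d.+1).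

(* The index set is infinite; for bounded S only finitely many terms are
   nonzero, which is what makes the sum meaningful. *)
Definition chi S x : R :=
  \sum_(k \in [set: 'rV[int]_d.+1]) (\1_S (x + intv R k) : R).

(* The torus with its Haar measure is represented by this fundamental domain
   with Lebesgue measure. *)
Definition unit_cube : set 'rV[R]_d.+1 := [set x | forall i, 0 <= x 0 i < 1].

Definition bounded_remainder_set alpha S :=
  [/\ bounded_set S,
      (@lebesgue_outer R d).-cara.-measurable S &
      exists C : R, forall n : nat, (0 < n)%N ->
        {ae mes, forall x : 'rV[R]_d.+1, unit_cube x ->
          `| \sum_(0 <= k < n) chi S (x + k%:R *: alpha)
             - n%:R * fine (mes S) | <= C}].

End bounded_remainder_set.

(* Main.v *)
Require Import Defs.
From mathcomp Require Import all_boot all_order all_algebra.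
From mathcomp Require Import finmap all_classical all_reals all_analysis.
From mathcomp Require Import measurable_realfun ring lra zify.

(** Why the theorem holds.  Write [orbit (k, m) = k alpha + m] for the points of
the group Z alpha + Z^d, indexed by pairs so that each point carries its time
[k].  For a bounded set A, the Birkhoff sum of the periodisation of A from y
up to time n counts the pairs (k, m) with 0 <= k < n and y + orbit (k, m) in A.
It suffices to bound, uniformly in n, how much this count changes with the
starting point y, for y outside a null set: integrated over the torus the count
is n times the measure of A, so a bounded oscillation is a bounded discrepancy
([steady_bounded_remainder]), and the density of visits never has to be
computed.

The basic case is a bounded fundamental domain X of the lattice spanned by
v_1, ..., v_d, where v_i = orbit w_i is a basis of R^d
([fundamental_domain_steady]).  Let ell be the linear form that sends v_i to the
time of w_i, and let t (k, m) = k - ell (orbit (k, m)), a corrected time that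
does not change when multiples of the w_i are added.  Reducing modulo these
vectors identifies the visits to X from y with the visits to X from y', and it
preserves t; adding a suitable multiple of one fixed pair u with t u > 0 makes up
for ell y' - ell y, up to a bounded error.  As ell is bounded on X, this is an
injection of the first visits into the second which moves times by a bounded
amount, so the counts differ by a bounded number.

A zonotope is reduced to this case one generator at a time ([region_steady]).
Let W be the span of some independent v_i with lattice Gamma, and let X be a
bounded fundamental domain of Gamma in Z + [0, 1] v + W, where v is not in W.
On every line in direction v the convex set Z + W is an interval I, and
([0, 1] + I) minus I contains exactly one point of each class modulo 1.
Hence the part of X inside Z + W is a fundamental domain of Gamma with one
generator less, and the part outside is one of Gamma + Z v.  If the generators
run out while W is still a proper subspace, then X is contained in W and is
never visited from a generic starting point.

That the generators may be taken in Z alpha + Z^d follows from the vertices: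
once parallel generators are merged, each generator is an edge, that is, a
difference of two vertices ([zono_generators]).

For a polygon S with vertices in the group, the counts of S and of -S have a
steady sum ([sym_hull_steady]): cutting along chords reduces this to triangles,
and a triangle and its opposite, suitably translated, form a parallelogram.  If
S is centrally symmetric then -S is a translate of S by a vector of the group,
which changes counts by a bounded amount, so twice the count of S is steady.

The measure theory used is the translation invariance of Lebesgue measure, the
measurability of closed sets, the value 1 on the unit cube, which is obtained by
slicing a cover by boxes ([cube_slicing]), and the fact that hyperplanes are
null ([hyperplane_null]). *)

Set Implicit Arguments.
Unset Strict Implicit.
Unset Printing Implicit Defensive.

Import Order.TTheory GRing.Theory Num.Theory.
Import numFieldNormedType.Exports.

Local Open Scope classical_set_scope.
Local Open Scope ring_scope.

(** * Counting visits of an orbit *)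

Section cardinal.
Context {T : choiceType}.
Implicit Types A B : set T.

Definition ncard A : nat := #|` fset_set A|.

Lemma ncard_sub A B : finite_set B -> A `<=` B -> (ncard A <= ncard B)%N.
Proof.
move=> fB AB; have fA := sub_finite_set AB fB.
by apply: fsubset_leq_card; rewrite -fset_set_sub.
Qed.

Lemma ncardU A B : finite_set A -> finite_set B -> A `&` B = set0 ->
  ncard (A `|` B) = (ncard A + ncard B)%N.
Proof.
move=> fA fB AB; rewrite /ncard fset_setU// cardfsU.
by rewrite -fset_setI// AB fset_set0 cardfs0 subn0.
Qed.

Lemma ncard0 : ncard set0 = 0%N.
Proof. by rewrite /ncard fset_set0 cardfs0. Qed.

End cardinal.

Lemma ncard_image (T U : choiceType) (f : T -> U) (A : set T) :
  finite_set A -> {in A &, injective f} -> ncard (f @` A) = ncard A.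
Proof.
move=> fA finj; rewrite /ncard fset_set_image// card_in_imfset//= => x y.
by rewrite !in_fset_set//; exact: finj.
Qed.

Lemma ncard_inj (T U : choiceType) (f : T -> U) (A : set T) (B : set U) :
  finite_set B -> (forall x, A x -> B (f x)) ->
  (forall x y, A x -> A y -> f x = f y -> x = y) ->
  finite_set A /\ (ncard A <= ncard B)%N.
Proof.
move=> fB fAB finj.
have injA : {in A &, injective f} by move=> x y; rewrite !inE; exact: finj.
have fAs : f @` A `<=` B by move=> _ [x Ax <-]; exact: fAB.
have fA : finite_set A.
  by rewrite -(eq_finite_set (inj_card_eq injA)); exact: sub_finite_set fB.
by split=> //; rewrite -(ncard_image fA injA); exact: ncard_sub.
Qed.

Section coordinates.
Context {R : realType} {d : nat}.
Implicit Types x : 'rV[R]_d.+1.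

Lemma rV_norm_le x (r : R) : 0 <= r ->
  (`|x| <= r) <-> (forall i, `|x 0 i| <= r).
Proof.
move=> r0; rewrite (_ : `|x| = mx_norm x)// mx_normrE; split.
  by move=> /bigmax_leP[_ h] i; exact: (h (0, i)).
move=> h; apply/bigmax_leP; split=> // -[a b] _ /=.
by rewrite (ord1 a); exact: h.
Qed.

Lemma rV_coord_le x i : `|x 0 i| <= `|x|.
Proof. by have /rV_norm_le : `|x| <= `|x| by []; apply. Qed.

End coordinates.

Section counting.
Context {R : realType} {d : nat}.
Local Notation V := 'rV[R]_d.+1.
Local Notation index := (int * 'rV[int]_d.+1)%type.
Variable alpha : V.
Implicit Types (A X : set V) (x y z : V) (l : index).

(** A pair is kept instead of the vector itself because arguments about visits
follow its first component, the time. *)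
Definition orbit l : V := l.1%:~R *: alpha + intv R l.2.

Lemma intvD (m n : 'rV[int]_d.+1) : intv R (m + n) = intv R m + intv R n.
Proof. by rewrite /intv map_mxD. Qed.

Lemma intvN (m : 'rV[int]_d.+1) : intv R (- m) = - intv R m.
Proof. by rewrite /intv map_mxN. Qed.

Lemma intv0 : intv R (0 : 'rV[int]_d.+1) = 0.
Proof. by rewrite /intv map_mx0. Qed.

Lemma orbitD l l' : orbit (l + l') = orbit l + orbit l'.
Proof. by rewrite /orbit/= intvD rmorphD/= scalerDl addrACA. Qed.

Lemma orbitN l : orbit (- l) = - orbit l.
Proof. by rewrite /orbit/= intvN rmorphN/= scaleNr opprD. Qed.

Lemma orbitB l l' : orbit (l - l') = orbit l - orbit l'.
Proof. by rewrite orbitD orbitN. Qed.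

Lemma orbit0 : orbit 0 = 0.
Proof. by rewrite -(subrr (0 : index)) orbitB subrr. Qed.

Lemma orbitMn l n : orbit (l *+ n) = orbit l *+ n.
Proof. by elim: n => [|n IH]; rewrite ?mulr0n ?orbit0// !mulrS orbitD IH. Qed.

Lemma orbitMz l (k : int) : orbit (l *~ k) = k%:~R *: orbit l.
Proof.
case: k => n; first by rewrite -pmulrn orbitMn -pmulrn scaler_nat.
by rewrite NegzE mulrNz -pmulrn orbitN orbitMn -scaler_nat rmorphN/= scaleNr.
Qed.

Definition slice A x : set 'rV[int]_d.+1 := [set m | A (x + intv R m)].

(** The Birkhoff sum of [chi A] along the rotation, as a natural number. *)
Definition visits A (n : nat) y : nat :=
  (\sum_(0 <= k < n) ncard (slice A (y + k%:R *: alpha)))%N.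

Lemma finite_bounded_int (N : nat) :
  finite_set [set m : 'rV[int]_d.+1 | forall i, `|m 0 i| <= N%:Z].
Proof.
pose f (g : {ffun 'I_d.+1 -> 'I_(N.*2.+1)}) : 'rV[int]_d.+1 :=
  \row_i ((g i : nat)%:Z - N%:Z).
apply: (@sub_finite_set _ _ (f @` setT)).
  move=> m /= mN; exists [ffun i => inord (absz (m 0 i + N%:Z))] => //.
  apply/rowP => i; rewrite !mxE ffunE inordK.
    by have := mN i; lia.
  by have := mN i; lia.
exact: finite_image.
Qed.

(** After a shift by the integer part of [x], every slice lies in one and the same
finite box of integer vectors. *)
Lemma slice_bound (r : R) : exists K : nat, forall A,
  (forall z, A z -> `|z| <= r) -> forall x,
  finite_set (slice A x) /\ (ncard (slice A x) <= K)%N.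
Proof.
have [r0|r0] := leP 0 r; last first.
  exists 0%N => A Ar x; suff -> : slice A x = set0.
    by rewrite ncard0; split=> //; exact: finite_set0.
  by by rewrite -subset0 => m mA; have := le_lt_trans (Ar _ mA) r0; rewrite normr_lt0.
pose N := (Num.truncn r).+2.
exists (ncard [set m : 'rV[int]_d.+1 | forall i, `|m 0 i| <= N%:Z]) => A Ar x.
pose f (m : 'rV[int]_d.+1) := m + \row_i Num.floor (x 0 i).
apply: (ncard_inj (f := f)); first exact: finite_bounded_int.
  move=> m /Ar/(rV_norm_le _ r0) /= h i; rewrite !mxE.
  have := h i; rewrite !mxE.
  have := floor_itv (x 0 i); rewrite rmorphD/= => /andP[x1 x2].
  have r1 := truncnS_gt r.
  rewrite -(ler_int R) intr_norm rmorphD/= !ler_norml => /andP[h1 h2].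
  rewrite /N -[_%:~R]pmulrn; move: r1; rewrite -!natr1 => r1.
  by apply/andP; split; lra.
by move=> m m' _ _ /addIr.
Qed.

Definition thin (K : nat) A :=
  forall x, finite_set (slice A x) /\ (ncard (slice A x) <= K)%N.

Lemma thin_sub K A X : A `<=` X -> thin K X -> thin K A.
Proof.
move=> AX tX x; have [fX sX] := tX x.
have sAX : slice A x `<=` slice X x by move=> m; exact: AX.
by split; [exact: sub_finite_set fX | exact: leq_trans (ncard_sub _ sAX) _].
Qed.

Definition visit_set A (n : nat) y : set index :=
  [set l | (0 <= l.1 < n%:Z) /\ A (y + orbit l)].

Lemma visits_card K A n y : thin K A ->
  finite_set (visit_set A n y) /\ ncard (visit_set A n y) = visits A n y.
Proof.
move=> tA; elim: n => [|n [IHf IHs]].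
  suff -> : visit_set A 0 y = set0.
    by rewrite ncard0 /visits big_geq//; split=> //; exact: finite_set0.
  by rewrite -subset0 => l [] /=; lia.
pose f (m : 'rV[int]_d.+1) : index := (n%:Z, m).
have finj : {in slice A (y + n%:R *: alpha) &, injective f} by move=> a b _ _ [].
have [fS _] := tA (y + n%:R *: alpha).
have fimS := finite_image f fS.
have -> : visit_set A n.+1 y = visit_set A n y `|` f @` slice A (y + n%:R *: alpha).
  apply/seteqP; split=> [[k m] [] /= kn Al | l].
    case/andP: kn => k0 kn.
    have [kltn|kgen] := ltP k n%:Z; first by left; split=> //=; rewrite k0.
    have kE : k = n%:Z by lia.
    right; exists m; last by rewrite /f kE.
    by move: Al; rewrite kE /slice/orbit/= addrA.
  case=> [[/= /andP[l0 ln] Al]|[m Sm <-]].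
    by split=> //; move: (l.1) l0 ln => k; lia.
  by split=> /=; [rewrite ltz_nat ltnSn | move: Sm; rewrite /slice/orbit/= addrA].
have disj : visit_set A n y `&` f @` slice A (y + n%:R *: alpha) = set0.
  rewrite -subset0 => l [[/andP[_ ln] _] [m _ lE]].
  by move: ln; rewrite -lE /= ltxx.
rewrite finite_setU ncardU// IHs ncard_image//; split=> //.
by rewrite /visits big_nat_recr.
Qed.

(** An injection of visits that moves times by at most [M] compares two counts: the
images fall into a time window of length [n + 2 M], and each of the [2 M]
additional instants contributes at most [K]. *)
Lemma visits_le_inj K A X n y y' (M : nat) (phi : index -> index) :
  thin K A -> thin K X ->
  (forall l, 0 <= l.1 < n%:Z -> A (y + orbit l) ->
     X (y' + orbit (phi l)) /\ - M%:Z <= (phi l).1 < n%:Z + M%:Z) ->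
  (forall l l', A (y + orbit l) -> A (y + orbit l') -> phi l = phi l' -> l = l') ->
  (visits A n y <= visits X n y' + (M * K).*2)%N.
Proof.
move=> tA tX phiX phi_inj.
have [_ <-] := visits_card n y tA.
pose psi l := phi l + (M%:Z, 0).
have [fX sX] := visits_card (n + M.*2) (y' - M%:R *: alpha) tX.
have psiP l : visit_set A n y l ->
    visit_set X (n + M.*2) (y' - M%:R *: alpha) (psi l).
  case=> /= /phiX/[apply] -[Xl Mn]; split.
    by rewrite /psi/=; move: (phi l).1 Mn => k; lia.
  rewrite /psi orbitD [orbit (_, _)]/orbit/= intv0 addr0.
  by rewrite -pmulrn addrACA addNr addr0.
have [] := ncard_inj fX psiP.
  by move=> l l' [ln Al] [ln' Al'] /addIr; exact: phi_inj.
move=> _ /leq_trans; apply; rewrite sX /visits.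
rewrite (@big_cat_nat _ _ _ (n + M))//=; last by lia.
rewrite (@big_cat_nat _ _ _ M)//=; last by lia.
have short a b (F : nat -> V) : (b - a = M)%N ->
    (\sum_(a <= k < b) ncard (slice X (F k)) <= M * K)%N.
  move=> <-; rewrite -sum_nat_const_nat; apply: leq_sum => k _.
  by have [] := tX (F k).
have -> : (\sum_(M <= k < n + M) ncard (slice X (y' - M%:R *: alpha + k%:R *: alpha))
           = \sum_(0 <= k < n) ncard (slice X (y' + k%:R *: alpha)))%N.
  rewrite -{1}[M]add0n big_addn addnK; apply: eq_big_nat => k _.
  by rewrite natrD scalerDl addrACA addNr addr0.
pose F k := y' - M%:R *: alpha + k%:R *: alpha.
have sA := short 0%N M F (subn0 M).
have sB : (\sum_(n + M <= k < n + M.*2) ncard (slice X (F k)) <= M * K)%N.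
  by apply: short; lia.
by rewrite -[(M * K).*2]addnn [X in (X + _)%N]addnC -addnA leq_add2l; exact: leq_add.
Qed.

Definition span_of (J : seq index) : 'M[R]_d.+1 :=
  foldr (fun w W => (orbit w + W)%MS) 0 J.

(** Generic points avoid the countably many proper affine subspaces spanned by
vectors of the group.  They form a set of full measure, invariant under the
group, on which boundaries of polytopes with vertices in the group are never
hit, so that closed and half-open pieces have the same visits. *)
Definition generic y := forall J l,
  ~~ row_full (span_of J) -> ~~ ((y + orbit l)%R <= span_of J)%MS.

(** Only the dependence on the starting point is controlled: the growth in [n] is
recovered at the end by integration over the torus. *)
Definition steady (F : nat -> V -> nat) := exists C : nat,
  forall n y y', generic y -> generic y' -> (F n y <= F n y' + C)%N.

End counting.

(** * Counts that depend little on the starting point *)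

Section steadiness.
Context {R : realType} {d : nat}.
Local Notation V := 'rV[R]_d.+1.
Local Notation index := (int * 'rV[int]_d.+1)%type.
Variable alpha : V.
Local Notation orbit := (orbit alpha).
Local Notation visits := (visits alpha).
Local Notation generic := (generic alpha).
Local Notation steady := (steady alpha).
Implicit Types (A X : set V) (x y z : V) (l : index).

Definition translate A (v : V) : set V := [set x | A (x - v)].

Lemma genericD y l : generic y -> generic (y + orbit l).
Proof. by move=> gy J l' nJ; rewrite -addrA -orbitD; exact: gy. Qed.

Lemma steady_null F : (forall n y, generic y -> F n y = 0%N) -> steady F.
Proof. by move=> F0; exists 0%N => n y y' gy gy'; rewrite !F0. Qed.

Lemma steadyD F G : steady F -> steady G -> steady (fun n y => F n y + G n y)%N.
Proof.
move=> [C FC] [D GD]; exists (C + D)%N => n y y' gy gy'.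
by rewrite addnACA; exact: leq_add (FC _ _ _ gy gy') (GD _ _ _ gy gy').
Qed.

Lemma steady_close (C : nat) F G :
  (forall n y, generic y -> (F n y <= G n y + C)%N /\ (G n y <= F n y + C)%N) ->
  steady G -> steady F.
Proof.
move=> FG [D GD]; exists (C + C + D)%N => n y y' gy gy'.
by have [? _] := FG n y gy; have [_ ?] := FG n y' gy'; have := GD n _ _ gy gy'; lia.
Qed.

Lemma eq_steady F G : (forall n y, generic y -> F n y = G n y) ->
  steady G -> steady F.
Proof.
by move=> FG; apply: (@steady_close 0) => n y gy; rewrite FG// addn0.
Qed.

Lemma steady_half F : steady (fun n y => F n y + F n y)%N -> steady F.
Proof.
by case=> C FC; exists C => n y y' gy gy'; have := FC n _ _ gy gy'; lia.
Qed.

Definition bounded_by (r : R) A := forall x, A x -> `|x| <= r.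

Lemma bounded_thin r A : bounded_by r A -> exists K, thin K A.
Proof. by move=> Ar; have [K KA] := slice_bound (d := d) r; exists K; exact: KA. Qed.

(** Moving the set by [k alpha + m] delays all visits by [k] units of time. *)
Lemma visits_shift K A l n y : thin K A ->
  (visits A n y <= visits (translate A (orbit l)) n y + (`|l.1| * K).*2)%N /\
  (visits (translate A (orbit l)) n y <= visits A n y + (`|l.1| * K).*2)%N.
Proof.
move=> tA; have tA' : thin K (translate A (orbit l)).
  move=> x; suff -> : slice (translate A (orbit l)) x = slice A (x - orbit l).
    exact: tA.
  by apply/funext => m; rewrite /slice/translate/= addrAC.
split.
  apply: (@visits_le_inj _ _ _ _ _ _ _ _ _ _ (fun l' => l' + l)) => //.
    move=> l' ln Al'; split; first by rewrite /translate/= orbitD addrA addrK.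
    by rewrite /=; move: (l'.1) (l.1) ln => a b; lia.
  by move=> ? ? _ _ /addIr.
apply: (@visits_le_inj _ _ _ _ _ _ _ _ _ _ (fun l' => l' - l)) => //.
  move=> l' ln Al'; split; first by rewrite orbitB addrA; exact: Al'.
  by rewrite /=; move: (l'.1) (l.1) ln => a b; lia.
by move=> ? ? _ _ /addIr.
Qed.

Lemma steady_shift r A l : bounded_by r A -> steady (visits A) ->
  steady (visits (translate A (orbit l))).
Proof.
move=> /bounded_thin[K tA]; apply: (@steady_close (`|l.1| * K).*2) => n y _.
by have [] := visits_shift l n y tA.
Qed.

Lemma visits_eq A X n y : generic y ->
  (forall z, generic z -> A z <-> X z) -> visits A n y = visits X n y.
Proof.
move=> gy AX; apply: eq_big_nat => k _; congr ncard; apply/funext => m.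
apply/propext; apply: AX; have := genericD (k%:Z, m) gy.
by rewrite /orbit/= -pmulrn addrA.
Qed.

Lemma visitsU K A X X' n y : generic y -> thin K X -> thin K X' ->
  (forall z, generic z -> A z <-> X z \/ X' z) ->
  (forall z, generic z -> X z -> X' z -> False) ->
  visits A n y = (visits X n y + visits X' n y)%N.
Proof.
move=> gy tX tX' AX XX'; rewrite (@visits_eq _ (X `|` X'))// /visits -big_split/=.
apply: eq_big_nat => k _; rewrite -ncardU.
- by [].
- by have [] := tX (y + k%:R *: alpha).
- by have [] := tX' (y + k%:R *: alpha).
- rewrite -subset0 => m [Xm X'm]; apply: XX' Xm X'm.
  by have := genericD (k%:Z, m) gy; rewrite /orbit/= -pmulrn addrA.
Qed.

(** Here [t l] is the time of [l] corrected by the linear form [ell], and [rho p] is the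
vector of [G] that brings [p] into [X].  The injection [phi] moves by a multiple
of [u], chosen so that the corrected time makes up for the change of starting
point, and then reduces modulo [G], which does not affect [t]. *)
Lemma fundamental_domain_steady (r : R) (G : set index) X (a : 'cV[R]_d.+1) :
  bounded_by r X ->
  (forall p, exists2 g, G g & X (p + orbit g)) ->
  (forall x g g', G g -> G g' -> X (x + orbit g) -> X (x + orbit g') -> g = g') ->
  (forall g, G g -> g.1%:~R = (orbit g *m a) 0 0) ->
  steady (visits X).
Proof.
move=> Xr Xex Xuniq Ga; have [K tX] := bounded_thin Xr.
pose ell x : R := (x *m a) 0 0.
have ellD x x' : ell (x + x') = ell x + ell x' by rewrite /ell mulmxDl mxE.
pose t l : R := l.1%:~R - ell (orbit l).
have tD l l' : t (l + l') = t l + t l'.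
  by rewrite /t orbitD ellD rmorphD/= opprD addrACA.
have t0 : t 0 = 0 by apply: (addrI (t 0)); rewrite -tD !addr0.
have tN l : t (- l) = - t l by apply/eqP; rewrite -addr_eq0 -tD addNr t0.
have tZ l (k : int) : t (l *~ k) = k%:~R * t l.
  have tMn n : t (l *+ n) = t l *+ n.
    by elim: n => [|n IH]; rewrite ?mulr0n ?t0// !mulrS tD IH.
  case: k => n; first by rewrite -!pmulrn tMn mulr_natl.
  by rewrite NegzE mulrNz -pmulrn tN tMn rmorphN/= -pmulrn mulNr mulr_natl.
have tG g : G g -> t g = 0 by move=> /Ga; rewrite /t /ell => ->; rewrite subrr.
(* If t vanished everywhere, ell would vanish on the integer vectors, hence be 0,
   but t (1, 0) = 1 in that case. *)
have [u u0] : exists u, 0 < t u.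
  suff [u] : exists u, t u != 0.
    by rewrite real_neqr_lt ?num_real// => /orP[tu|tu];
      [exists (- u); rewrite tN oppr_gt0 | exists u].
  apply: contrapT => /forallNP tn0.
  have tu0 u : t u = 0 by apply/eqP/negPn/negP; exact: tn0.
  have a0 : a = 0.
    apply/colP => i; rewrite mxE; have := tu0 (0, delta_mx 0 i).
    rewrite /t /orbit/= mulr0z scale0r !add0r => /eqP; rewrite oppr_eq0.
    have -> : intv R (delta_mx 0 i) = delta_mx 0 i by rewrite /intv map_delta_mx.
    by rewrite /ell -rowE mxE => /eqP.
  have := tu0 (1, 0); rewrite /t /ell a0 mulmx0 mxE subr0 => /eqP.
  by rewrite oner_eq0.
pose M0 := `|r| * \sum_i `|a i 0|.
have ellX x : X x -> `|ell x| <= M0.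
  move=> /Xr xr; rewrite /ell mxE (le_trans (ler_norm_sum _ _ _))//.
  rewrite /M0 mulr_sumr ler_sum// => i _; rewrite normrM ler_wpM2r//.
  by rewrite (le_trans (rV_coord_le _ _))// (le_trans xr)// ler_norm.
(* Rounding to a multiple of u costs at most t u, and ell at both ends at most M0. *)
pose M := (Num.truncn (t u + M0 + M0)).+1.
exists (M * K).*2 => n y y' _ _.
have [rho rhoP] : {rho : V -> index & forall p, G (rho p) /\ X (p + orbit (rho p))}.
  apply: (@choice _ _ (fun p g => G g /\ X (p + orbit g))) => p.
  by have [g] := Xex p; exists g.
pose j := Num.floor ((ell y' - ell y) / t u).
pose phi l := l + u *~ j + rho (y' + orbit (l + u *~ j)).
apply: (@visits_le_inj _ _ _ _ _ _ _ _ _ _ phi) => //.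
  move=> l ln Xl; have [Grho Xrho] := rhoP (y' + orbit (l + u *~ j)).
  have Xphi : X (y' + orbit (phi l)) by rewrite /phi orbitD addrA.
  split=> //.
  have tphi : t (phi l) = t l + j%:~R * t u by rewrite /phi !tD (tG _ Grho) addr0 tZ.
  have /andP[j1 j2] := floor_itv ((ell y' - ell y) / t u).
  rewrite -/j in j1 j2; rewrite ler_pdivlMr// in j1; rewrite ltr_pdivrMr// in j2.
  rewrite rmorphD/= mulrDl mul1r in j2.
  have Mgt := truncnS_gt (t u + M0 + M0); rewrite -/M in Mgt.
  have := ellX _ Xl; have := ellX _ Xphi.
  rewrite (ellD y') (ellD y) !ler_norml => /andP[e1 e2] /andP[e3 e4].
  have dist : `|((phi l).1 - l.1)%:~R : R| < (M%:Z)%:~R.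
    rewrite -pmulrn; apply: le_lt_trans Mgt; rewrite intrB ler_norml.
    have {}tphi : (phi l).1%:~R - ell (orbit (phi l)) =
        l.1%:~R - ell (orbit l) + j%:~R * t u := tphi.
    by clearbody M0 t phi; apply/andP; split; lra.
  rewrite -intr_norm ltr_int in dist.
  by move: (l.1) ((phi l).1) ln dist => b e; lia.
move=> l l' Xl Xl' phiE.
have [G1 _] := rhoP (y' + orbit (l + u *~ j)).
have [G2 _] := rhoP (y' + orbit (l' + u *~ j)).
move: phiE; rewrite /phi; set g := rho _ in G1 *; set g' := rho _ in G2 *.
rewrite addrAC [RHS]addrAC => /addIr phiE.
suff gg' : g = g' by move: phiE; rewrite gg' => /addIr.
apply: (Xuniq (y + orbit l - orbit g') g g' G1 G2).
  by rewrite addrAC -[y + _ + _]addrA -orbitD phiE orbitD addrA addrK.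
by rewrite subrK.
Qed.

End steadiness.

(** * Fundamental domains inside zonotopes *)

Section zonotopes.
Context {R : realType} {E : lmodType R}.
Implicit Types (L : seq E) (x y v : E).

(** The Minkowski sum of the segments [[0, v]], built one generator at a time. *)
Fixpoint zono L : set E :=
  if L is v :: L' then [set x | exists2 t : R, 0 <= t <= 1 & zono L' (x - t *: v)]
  else [set 0].

Lemma zono_convex L x y (t : R) : 0 <= t <= 1 -> zono L x -> zono L y ->
  zono L (t *: x + (1 - t) *: y).
Proof.
move=> /andP[t0 t1]; elim: L x y => [|v L IH] x y /=.
  by move=> -> ->; rewrite !scaler0 addr0.
move=> [a /andP[a0 a1] xL] [b /andP[b0 b1] yL].
exists (t * a + (1 - t) * b); first by apply/andP; split; nra.
have := IH _ _ xL yL; congr (zono L).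
by rewrite !scalerBr !scalerA addrACA -opprD -scalerDl.
Qed.

End zonotopes.

(** With [interval_step_uniq]: for a bounded nonempty interval [I] of any kind, open or
closed, the set ([[0, 1]] + I) minus [I] is a fundamental domain for the integers.
Existence comes from the least integer that is outside [I] and not below the
given point of [I]. *)
Lemma interval_step (R : realType) (I : R -> Prop) (B s : R) :
  (forall a b c, I a -> I b -> a <= c <= b -> I c) ->
  (forall a, I a -> a <= B) -> I s ->
  exists k : int, ~ I k%:~R /\ exists2 t : R, 0 <= t <= 1 & I (k%:~R - t).
Proof.
move=> Iconv IB Is; have /andP[f1 f2] := floor_itv s.
rewrite rmorphD/= in f2.
pose Q j := `[< s <= (Num.floor s + j%:Z)%:~R /\ ~ I (Num.floor s + j%:Z)%:~R >].
have exQ : exists j, Q j.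
  have Bs := truncnS_gt (B - s); set N := (Num.truncn _).+1 in Bs.
  exists N.+1; apply/asboolP; rewrite rmorphD/= -pmulrn -natr1.
  split; first by have := ler0n R N; lra.
  by move=> /IB; lra.
have [j /asboolP[sj nIj] jmin] := ex_minnP exQ.
exists (Num.floor s + j%:Z); split=> //.
case: j => [|j] in sj nIj jmin *.
  by rewrite addr0 in sj nIj *; case: nIj; apply: (Iconv s s) => //; rewrite f1 sj.
have nQ : ~ Q j by move=> /jmin; rewrite ltnn.
have [sgt|/contrapT Ij] := (not_andP _ _).1 (contra_not (@asboolT _) nQ).
  exists ((Num.floor s + j.+1%:Z)%:~R - s); last by rewrite subKr.
  move/negP: sgt; rewrite -ltNge !rmorphD/= -!pmulrn -natr1 in sj *.
  by move=> sgt; apply/andP; split; lra.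
exists 1; rewrite ?lexx ?ler01//; move: Ij.
by congr I; rewrite !rmorphD/= -!pmulrn -natr1 addrA addrK.
Qed.

Lemma interval_step_uniq (R : realType) (I : R -> Prop) (k : int) :
  (forall a b c, I a -> I b -> a <= c <= b -> I c) ->
  ~ I 0 -> (exists2 t : R, 0 <= t <= 1 & I (0 - t)) ->
  ~ I k%:~R -> (exists2 t : R, 0 <= t <= 1 & I (k%:~R - t)) -> k = 0.
Proof.
move=> Iconv nI0 [t /andP[t0 t1] It] nIk [u /andP[u0 u1] Iu].
case: (ltgtP k 0) => // k0.
  have k1 : k%:~R <= -1 :> R.
    by rewrite -[-1]/((-1)%:~R) ler_int; move: k0; clear; lia.
  by case: nIk; apply: (Iconv _ _ _ Iu It); apply/andP; split; lra.
have k1 : 1 <= k%:~R :> R by rewrite -[1]/(1%:~R) ler_int; move: k0; clear; lia.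
by case: nI0; apply: (Iconv _ _ _ It Iu); apply/andP; split; lra.
Qed.

(** The columns of the cokernel of [W] are the linear forms that vanish on [W]. *)
Lemma separating_functional (F : fieldType) m n (W : 'M[F]_(m, n)) (v : 'rV[F]_n) :
  ~~ (v <= W)%MS -> exists b : 'cV[F]_n, W *m b = 0 /\ (v *m b) 0 0 = 1.
Proof.
rewrite submxE => /rV0Pn[j vj].
exists (((v *m cokermx W) 0 j)^-1 *: col j (cokermx W)).
rewrite colE -!scalemxAr; split.
  by rewrite (mulmxA W (cokermx W)) mulmx_coker mul0mx scaler0.
by rewrite (mulmxA v (cokermx W)) -colE mxE [in X in _ * X]mxE mulVf.
Qed.

Section region.
Context {R : realType} {d : nat}.
Local Notation V := 'rV[R]_d.+1.
Local Notation index := (int * 'rV[int]_d.+1)%type.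
Variable alpha : V.
Local Notation orbit := (orbit alpha).
Local Notation visits := (visits alpha).
Local Notation generic := (generic alpha).
Local Notation steady := (steady alpha).
Local Notation span_of := (span_of alpha).
Implicit Types (X : set V) (x y z v : V) (l w g : index) (L J : seq index).

Lemma zono_bounded (L : seq V) : exists r, bounded_by r (zono L).
Proof.
elim: L => [|v L [r Lr]] /=; first by exists 0 => x ->; rewrite normr0.
exists (r + `|v|) => x [t /andP[t0 t1] /Lr xr].
rewrite -(subrK (t *: v) x) (le_trans (ler_normD _ _))// lerD//.
by rewrite normrZ ger0_norm// ler_piMl.
Qed.

(** The integral span of [J]; it consists of pairs, so it also records times. *)
Fixpoint lattice J : set index :=
  if J is w :: J' then [set g | exists k : int, lattice J' (g - w *~ k)]
  else [set 0].

Lemma lattice_span J g : lattice J g -> (orbit g <= span_of J)%MS.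
Proof.
elim: J g => [|w J IH] g /=; first by move=> ->; rewrite orbit0 sub0mx.
case=> k /IH; rewrite orbitB orbitMz => gJ.
rewrite -(subrK (k%:~R *: orbit w) (orbit g)) addrC addmx_sub_adds//.
exact: scalemx_sub.
Qed.

Definition region L J : set V :=
  [set x | exists2 z, zono (map orbit L) z & ((x - z)%R <= span_of J)%MS].

Lemma regionD L J x v : (v <= span_of J)%MS -> region L J x -> region L J (x + v).
Proof. by move=> vJ [z Lz xz]; exists z => //; rewrite addrAC addmx_sub. Qed.

Lemma regionDE L J x v : (v <= span_of J)%MS -> region L J (x + v) <-> region L J x.
Proof.
move=> vJ; split; last exact: regionD.
by move=> /(@regionD _ _ _ (- v)); rewrite addrK; apply; rewrite eqmx_opp.
Qed.

Lemma region_convex L J x y (t : R) : 0 <= t <= 1 ->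
  region L J x -> region L J y -> region L J (t *: x + (1 - t) *: y).
Proof.
move=> t01 [a La xa] [b Lb yb].
exists (t *: a + (1 - t) *: b); first exact: zono_convex.
by rewrite opprD addrACA -!scalerBr addmx_sub// scalemx_sub.
Qed.

Lemma region_line_convex L J x v (a b c : R) :
  region L J (x + a *: v) -> region L J (x + b *: v) -> a <= c <= b ->
  region L J (x + c *: v).
Proof.
move=> xa xb /andP[ac cb]; have [ab|ab] := ltP a b; last first.
  by have -> : c = a by lra.
have ba : b - a != 0 by rewrite subr_eq0 gt_eqF.
pose t := (b - c) / (b - a).
have t01 : 0 <= t <= 1.
  rewrite /t divr_ge0 ?subr_ge0 ?(ltW ab)//= ler_pdivrMr ?subr_gt0// mul1r.
  by rewrite lerD2l lerN2.
have := region_convex t01 xa xb; congr (region L J).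
rewrite !scalerDr addrACA -scalerDl [t + _]addrC subrK scale1r !scalerA -scalerDl.
by congr (_ + _ *: _); rewrite /t; field.
Qed.

Lemma region_cons L J w x : region (w :: L) J x <->
  exists2 t : R, 0 <= t <= 1 & region L J (x - t *: orbit w).
Proof.
split.
  case=> z [t t01 Lz] xz; exists t => //; exists (z - t *: orbit w) => //.
  by rewrite opprB addrA subrK.
case=> t t01 [z Lz xz]; exists (z + t *: orbit w).
  by exists t => //; rewrite addrK.
by rewrite opprD addrA addrAC.
Qed.

Lemma region_span_cons L J w x : region L (w :: J) x <->
  exists s : R, region L J (x + s *: orbit w).
Proof.
split.
  case=> z Lz /sub_addsmxP[[a b]] /= /eqP; rewrite subr_eq => /eqP xE.
  exists (- a 0 0); exists z => //.
  have -> : x + - a 0 0 *: orbit w - z = b *m span_of J.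
    have aE : a *m orbit w = a 0 0 *: orbit w by rewrite {1}[a]mx11_scalar mul_scalar_mx.
    by rewrite xE aE scaleNr addrAC addrK addrAC subrr add0r.
  exact: submxMl.
case=> s [z Lz xz]; exists z => //=.
have -> : x - z = (- s) *: orbit w + (x + s *: orbit w - z).
  by rewrite scaleNr -addrA addrCA addKr.
by rewrite addmx_sub_adds// scalemx_sub.
Qed.

Lemma region_cons_in_span L J w x : (orbit w <= span_of J)%MS ->
  region (w :: L) J x -> region L J x.
Proof.
move=> wJ /region_cons[t _]; rewrite -scaleNr.
by move/regionDE; apply; exact: scalemx_sub.
Qed.

Lemma visits0 n y : visits set0 n y = 0%N.
Proof. by rewrite /visits big1// => k _; exact: ncard0. Qed.

Lemma generic_notin_span J y : generic y -> ~~ row_full (span_of J) ->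
  ~~ (y <= span_of J)%MS.
Proof. by move=> gy /(gy J 0); rewrite orbit0 addr0. Qed.

Lemma steady_avoided X : (forall z, generic z -> ~ X z) -> steady (visits X).
Proof.
move=> X0; apply: steady_null => n y gy; rewrite (@visits_eq _ _ _ _ set0) ?visits0//.
by move=> z gz; split=> // /X0; exact.
Qed.

(** The hypotheses say that [X] is a bounded fundamental domain of [lattice J] in
[region L J], and that the linear form [a] computes the times of lattice
vectors.  Induction on [L] with [J] general: a generator [w] outside the span of
[J] splits [X] into the part [X1] in [region L J] and the part [X2] outside, which
is a fundamental domain of [lattice (w :: J)] in [region L (w :: J)]. *)
Lemma region_steady L J X (r : R) (a : 'cV[R]_d.+1) :
  bounded_by r X -> X `<=` region L J ->
  (forall p, region L J p -> exists2 g, lattice J g & X (p + orbit g)) ->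
  (forall x g g', lattice J g -> lattice J g' ->
     X (x + orbit g) -> X (x + orbit g') -> g = g') ->
  (forall g, lattice J g -> g.1%:~R = (orbit g *m a) 0 0) ->
  steady (visits X).
Proof.
elim: L J X a => [|w L IH] J X a Xr Xreg Xex Xuniq Ja.
  have [Jfull|Jfull] := boolP (row_full (span_of J)).
    apply: (fundamental_domain_steady Xr _ Xuniq Ja) => p; apply: Xex.
    by exists 0 => //; exact: submx_full.
  apply: steady_avoided => z gz /Xreg[_ -> zJ].
  by have := generic_notin_span gz Jfull; rewrite subr0 in zJ; rewrite zJ.
have [wJ|wJ] := boolP (orbit w <= span_of J)%MS.
  apply: (IH J X a) => // [x /Xreg/(region_cons_in_span wJ)//|p pL].
  apply: Xex; apply/region_cons; exists 0; first by rewrite lexx ler01.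
  by rewrite scale0r subr0.
have [K tX] := bounded_thin Xr.
have [b [Jb wb]] := separating_functional wJ.
pose psi x : R := (x *m b) 0 0.
have psiD x x' : psi (x + x') = psi x + psi x' by rewrite /psi mulmxDl mxE.
have psiZ t x : psi (t *: x) = t * psi x by rewrite /psi -scalemxAl mxE.
have psiJ x : (x <= span_of J)%MS -> psi x = 0.
  by case/submxP => D ->; rewrite /psi -mulmxA Jb mulmx0 mxE.
have [rL Lr] := zono_bounded (map orbit L).
have psi_bound x : region L J x -> psi x <= `|rL| * \sum_i `|b i 0|.
  case=> z Lz /psiJ/eqP; rewrite psiD -scaleN1r psiZ mulN1r subr_eq0 => /eqP ->.
  rewrite (le_trans (ler_norm _))// /psi mxE (le_trans (ler_norm_sum _ _ _))//.
  rewrite mulr_sumr ler_sum// => i _; rewrite normrM ler_wpM2r//.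
  by rewrite (le_trans (rV_coord_le _ _))// (le_trans (Lr _ Lz))// ler_norm.
pose X1 := X `&` region L J; pose X2 := X `\` region L J.
have X1X : X1 `<=` X by move=> x [].
have X2X : X2 `<=` X by move=> x [].
apply: (@eq_steady _ _ _ _ (fun n y => visits X1 n y + visits X2 n y)%N).
  move=> n y gy; apply: (visitsU n gy (thin_sub X1X tX) (thin_sub X2X tX)).
    move=> z _; split=> [Xz|[]]; [|exact: X1X|exact: X2X].
    by have [zL|zL] := pselect (region L J z); [left|right].
  by move=> z _ [_ zL] [_].
apply: steadyD.
  apply: (IH J X1 a) => //.
  - by move=> x /X1X/Xr.
  - by move=> x [].
  - move=> p pL; have [|g Jg Xg] := Xex p.
      apply/region_cons; exists 0; first by rewrite lexx ler01.
      by rewrite scale0r subr0.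
    by exists g => //; split=> //; apply: regionD pL; exact: lattice_span.
  - by move=> x g g' Jg Jg' /X1X Xg /X1X; exact: Xuniq Xg.
pose I p (s : R) := region L J (p + s *: orbit w).
have Iconv p s1 s2 s : I p s1 -> I p s2 -> s1 <= s <= s2 -> I p s.
  exact: region_line_convex.
have X2w x : X2 x -> exists2 t : R, 0 <= t <= 1 & region L J (x - t *: orbit w).
  by move=> /X2X/Xreg/region_cons.
(* The linear form is corrected so that it also takes the right value at w. *)
apply: (IH (w :: J) X2 (a + (w.1%:~R - (orbit w *m a) 0 0) *: b)).
- by move=> x /X2X/Xr.
- move=> x /X2w[t _ xt]; apply/region_span_cons; exists (- t).
  by rewrite scaleNr.
- move=> p /region_span_cons[s ps].
  pose bound := `|rL| * (\sum_i `|b i 0|) - psi p.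
  have [|k [nk [t t01 kt]]] := @interval_step _ (I p) bound s (Iconv p) _ ps.
    by move=> u /psi_bound; rewrite psiD psiZ /psi wb mulr1 lerBrDl.
  have [|g Jg Xg] := Xex (p + k%:~R *: orbit w).
    by apply/region_cons; exists t => //; rewrite -addrA -scalerBl.
  have pE : p + orbit (g + w *~ k) = p + k%:~R *: orbit w + orbit g.
    by rewrite orbitD orbitMz [orbit g + _]addrC addrA.
  exists (g + w *~ k); first by exists k; rewrite addrK.
  rewrite pE; split=> //.
  by move/(regionDE _ _ (lattice_span Jg)).
- move=> x g g' [k Jk] [k' Jk'] Xg Xg'.
  (* Seen from p, both points have multiples of w whose difference is k' - k. *)
  pose p := x + k%:~R *: orbit w.
  have split_off h (j : int) : x + orbit h =
      p + (j - k)%:~R *: orbit w + orbit (h - w *~ j).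
    rewrite /p rmorphB/= scalerBl orbitB orbitMz -addrA [X in _ = _ + X]addrC.
    by rewrite subrKA [orbit h - _]addrC [RHS]addrA addrK.
  have inI h j : lattice J (h - w *~ j) -> X2 (x + orbit h) ->
      ~ I p (j - k)%:~R /\
      exists2 t : R, 0 <= t <= 1 & I p ((j - k)%:~R - t).
    move=> /lattice_span hJ Xh; have [t t01] := X2w _ Xh.
    case: Xh => _; rewrite (split_off h j) => nreg reg; split.
      by move=> Ip; apply: nreg; exact: regionD.
    exists t => //; move: reg; rewrite addrAC => /(regionDE _ _ hJ).
    by rewrite /I scalerBl addrA.
  have [nk kt] := inI g k Jk Xg; have [nk' kt'] := inI g' k' Jk' Xg'.
  rewrite subrr in nk kt.
  have kk' : k' = k.
    apply/eqP; rewrite -subr_eq0; apply/eqP.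
    exact: (interval_step_uniq (Iconv p) nk kt nk' kt').
  have := Xuniq p _ _ Jk Jk'; rewrite kk'.
  have := X2X _ Xg; rewrite (split_off g k) subrr scale0r addr0 => pg.
  have := X2X _ Xg'; rewrite (split_off g' k) subrr scale0r addr0 => pg'.
  by move=> /(_ pg pg') /addIr.
- move=> g [k Jk]; rewrite -(subrK (w *~ k) g); set g0 := g - w *~ k in Jk *.
  have ellE c x : (x *m (a + c *: b)) 0 0 = (x *m a) 0 0 + c * psi x.
    by rewrite mulmxDr -scalemxAr [LHS]mxE [X in _ + X]mxE.
  have -> : (g0 + w *~ k).1 = g0.1 + w.1 * k by rewrite /= -mulrzz raddfMz.
  rewrite ellE orbitD orbitMz psiD psiZ psiJ ?(lattice_span Jk)// /psi wb.
  rewrite mulmxDl -scalemxAl [X in _ = X + _]mxE [X in _ = _ + X + _]mxE.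
  by rewrite -(Ja _ Jk) intrD intrM; ring.
Qed.

(** The case of [region_steady] where [J] is empty: the zonotope is its own
fundamental domain for the trivial lattice. *)
Lemma zono_steady L l : steady (visits (translate (zono (map orbit L)) (orbit l))).
Proof.
have [r Lr] := zono_bounded (map orbit L); apply: (steady_shift l Lr).
have reg x : region L [::] x <-> zono (map orbit L) x.
  split; last by move=> Lx; exists x => //; rewrite subrr sub0mx.
  by case=> z Lz; rewrite submx0 subr_eq0 => /eqP ->.
apply: (region_steady (J := [::]) (a := 0) Lr) => /=.
- by move=> x Lx; apply/reg.
- by move=> p /reg Lp; exists 0 => //; rewrite orbit0 addr0.
- by move=> x g g' -> ->.
- by move=> g ->; rewrite mulmx0 mxE.
Qed.

End region.

(** * The edges of a zonotope *)

Section reduction.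
Context {R : realType} {n : nat}.
Local Notation V := 'rV[R]_n.+1.
Implicit Types (L M : seq V) (x y v u c : V).

Lemma zono_swap v u L : zono (v :: u :: L) = zono (u :: v :: L).
Proof.
by apply/seteqP; split=> x /= [t t01 [s s01 xL]]; exists s => //; exists t => //;
  rewrite addrAC.
Qed.

Lemma zono_rem v L : v \in L -> zono L = zono (v :: rem v L).
Proof.
elim: L => //= u L IH; rewrite inE eq_sym; case: eqVneq => [-> //|_ /=] /IH zL.
have -> : [set x | exists2 t : R, 0 <= t <= 1 & zono L (x - t *: u)] = zono (u :: L).
  by [].
by rewrite -[RHS]/(zono (v :: u :: rem v L)) zono_swap /= zL.
Qed.

Lemma zono_merge_pos (a : R) v L : 0 <= a ->
  zono (v :: a *: v :: L) = zono ((1 + a) *: v :: L).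
Proof.
move=> a0; apply/seteqP; split=> x /=.
  move=> [t /andP[t0 t1] [s /andP[s0 s1]]] xL.
  exists ((t + s * a) / (1 + a)).
    by rewrite divr_ge0 ?ler_pdivrMr; nra.
  move: xL; rewrite !scalerA divfK; last by apply/eqP; nra.
  by rewrite scalerDl opprD addrA.
move=> [t t01]; rewrite !scalerA mulrDr mulr1 scalerDl opprD addrA => xL.
by exists t => //; exists t => //; rewrite scalerA.
Qed.

(** Parallel segments pointing in opposite directions add up to a single segment, up
to a translation. *)
Lemma zono_merge_neg (a : R) v L : a <= 0 ->
  zono (v :: a *: v :: L) = translate (zono ((1 - a) *: v :: L)) (a *: v).
Proof.
move=> a0; apply/seteqP; split=> x /=; rewrite /translate/=.
  move=> [t /andP[t0 t1] [s /andP[s0 s1]]] xL.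
  exists ((t + (s - 1) * a) / (1 - a)).
    by rewrite divr_ge0 ?ler_pdivrMr; nra.
  move: xL; rewrite !scalerA divfK; last by apply/eqP; nra.
  by rewrite -!addrA -!opprD -!scalerDl; congr (zono L (_ - _ *: _)); ring.
move=> [t /andP[t0 t1]]; rewrite !scalerA => xL.
exists t; first by rewrite t0.
exists (1 - t); first by apply/andP; split; lra.
move: xL; rewrite scalerA -!addrA -!opprD -!scalerDl.
by congr (zono L (_ - _ *: _)); ring.
Qed.

Lemma avoid_seq (s : seq R) : exists t : R, t \notin s.
Proof.
pose S : R := \sum_(x <- s) `|x|; exists (1 + S); apply/negP => Ss.
have S_ge (x : R) : x \in s -> `|x| <= S.
  by move=> xs; rewrite /S (big_rem x)//= lerDl sumr_ge0.
by have := S_ge _ Ss; have := ler_norm (1 + S); clearbody S; lra.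
Qed.

(** A linear form that vanishes on [v] and on none of the other generators exhibits
[v] as an edge direction.  Treating the generators in turn, one adds a multiple of
a form that vanishes on [v] but not on the new generator, and avoids the finitely
many multiples for which the sum vanishes on some generator. *)
Lemma edge_functional v M : (forall u, u \in M -> ~~ (u <= v)%MS) ->
  exists b : 'cV[R]_n.+1, v *m b = 0 /\ forall u, u \in M -> (u *m b) 0 0 != 0.
Proof.
elim: M => [|u M IH] uv; first by exists 0; rewrite mulmx0.
have [|b [vb Mb]] := IH; first by move=> w wM; apply: uv; rewrite inE wM orbT.
have [b' [vb' ub']] := separating_functional (uv u (mem_head _ _)).
have [t tP] := avoid_seq [seq - (w *m b) 0 0 / (w *m b') 0 0 | w <- u :: M].
exists (b + t *: b'); split; first by rewrite mulmxDr -scalemxAr vb vb' scaler0 addr0.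
move=> w wM; rewrite mulmxDr -scalemxAr mxE [X in _ + X]mxE.
have [w0|w0] := eqVneq ((w *m b') 0 0) 0.
  rewrite w0 mulr0 addr0; apply: Mb; move: wM; rewrite inE => /predU1P[wu|//].
  by move: w0; rewrite wu ub' => /eqP; rewrite oner_eq0.
apply: contra tP => /eqP tw; apply/mapP; exists w => //.
by apply: (mulIf w0); rewrite divfK//; lra.
Qed.

(** The point of the zonotope of [M] where the linear form [b] is largest. *)
Definition top (b : 'cV[R]_n.+1) M : V := \sum_(u <- M | 0 < (u *m b) 0 0) u.

Lemma zono_top b M : zono M (top b M).
Proof.
rewrite /top; elim: M => [|u M IH]; first by rewrite big_nil.
rewrite big_cons; case: ifP => _ /=.
  by exists 1; rewrite ?lexx ?ler01// scale1r addrC addKr.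
by exists 0; rewrite ?lexx ?ler01// scale0r subr0.
Qed.

Lemma top_unique b M x : (forall u, u \in M -> (u *m b) 0 0 != 0) -> zono M x ->
  (x *m b) 0 0 <= (top b M *m b) 0 0 /\
  ((x *m b) 0 0 = (top b M *m b) 0 0 -> x = top b M).
Proof.
pose psi y := (y *m b) 0 0.
have psiD y z : psi (y + z) = psi y + psi z by rewrite /psi mulmxDl mxE.
have psiZ a y : psi (a *: y) = a * psi y by rewrite /psi -scalemxAl mxE.
rewrite -![(_ *m b) 0 0]/(psi _) /top.
elim: M x => [|u M IH] x Mb /=; first by rewrite big_nil => ->.
case=> t /andP[t0 t1] xM.
have [|le_top eq_top] := IH _ _ xM; first by move=> w wM; apply: Mb; rewrite inE wM orbT.
have u0 : psi u != 0 by apply: Mb; rewrite mem_head.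
have xE : x = t *: u + (x - t *: u) by rewrite addrC subrK.
have := congr1 psi xE; rewrite psiD psiZ => psix.
rewrite big_cons -/(psi u); case: ltP => u_sign.
  rewrite psiD; split; first by nra.
  move=> eqx; have t1' : t = 1 by nra.
  have tu : t * psi u = psi u by rewrite t1' mul1r.
  by rewrite xE eq_top; [rewrite t1' scale1r | lra].
have {}u_sign : psi u < 0 by rewrite lt_neqAle u0.
split; first by nra.
move=> eqx; have t0' : t = 0 by nra.
have tu : t * psi u = 0 by rewrite t0' mul0r.
by rewrite xE eq_top; [rewrite t0' scale0r add0r | lra].
Qed.

(** The face where [b] is largest is the segment [c + top b M + [0, 1] v], and the end
points of a face that is a segment are vertices. *)
Lemma edge_vertices b v M c (s : R) :
  v *m b = 0 -> (forall u, u \in M -> (u *m b) 0 0 != 0) -> s = 0 \/ s = 1 ->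
  vertices (translate (zono (v :: M)) c) (c + (top b M + s *: v)).
Proof.
move=> vb Mb s01; have s_itv : 0 <= s <= 1 by case: s01 => ->; rewrite ?lexx ?ler01.
split.
  rewrite /translate/=; exists s => //.
  by rewrite [c + _]addrC !addrK; exact: zono_top.
pose psi y := (y *m b) 0 0.
have psiD y z : psi (y + z) = psi y + psi z by rewrite /psi mulmxDl mxE.
have psiZ a y : psi (a *: y) = a * psi y by rewrite /psi -scalemxAl mxE.
have psiv : psi v = 0 by rewrite /psi vb mxE.
move=> x y t [p p01 xM] [q q01 yM] t0 t1 xy.
have [xle xeq] := top_unique Mb xM; have [yle yeq] := top_unique Mb yM.
rewrite -![(_ *m b) 0 0]/(psi _) in xle xeq yle yeq.
pose xc := x - c - p *: v; pose yc := y - c - q *: v.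
have xE : x = c + xc + p *: v by rewrite /xc -addrA subrK addrC subrK.
have yE : y = c + yc + q *: v by rewrite /yc -addrA subrK addrC subrK.
rewrite -/xc in xle xeq; rewrite -/yc in yle yeq; clearbody xc yc.
have := congr1 psi xy; rewrite xE yE !(psiD, psiZ) psiv => psiE.
have xgap : 0 <= t * (psi (top b M) - psi xc) by rewrite mulr_ge0 ?subr_ge0// ltW.
have ygap : 0 <= (1 - t) * (psi (top b M) - psi yc) by rewrite mulr_ge0 ?subr_ge0// ltW.
have xt : xc = top b M.
  have /eqP : t * (psi (top b M) - psi xc) = 0 by lra.
  by rewrite mulf_eq0 gt_eqF//= subr_eq0 => /eqP/esym/xeq.
have yt : yc = top b M.
  have /eqP : (1 - t) * (psi (top b M) - psi yc) = 0 by lra.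
  by rewrite mulf_eq0 subr_eq0 gt_eqF//= subr_eq0 => /eqP/esym/yeq.
have [v0|v0] := eqVneq v 0; first by rewrite xt yt v0 !scaler0 !addr0.
have sE : s = t * p + (1 - t) * q.
  apply/eqP; rewrite -subr_eq0 -(orbF (_ == 0)) -(negPf v0) -scaler_eq0 scalerBl.
  rewrite subr_eq0; apply/eqP/(addrI (c + top b M)).
  have mix A : t *: (A + p *: v) + (1 - t) *: (A + q *: v) =
      A + (t * p + (1 - t) * q) *: v.
    rewrite !scalerDr addrACA -scalerDl [t + _]addrC subrK scale1r.
    by rewrite !scalerA -scalerDl.
  by rewrite -mix -addrA xy xE yE xt yt.
have [-> ->] : p = s /\ q = s.
  by move: p01 q01 => /andP[? ?] /andP[? ?]; split; case: s01 => s01; nra.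
by rewrite xt yt addrA.
Qed.

End reduction.

Section lattice_generators.
Context {R : realType} {d : nat}.
Local Notation V := 'rV[R]_d.+1.
Variable alpha : V.
Local Notation orbit := (orbit alpha).
Local Notation G := (rotation_group alpha).
Implicit Types (L M : seq V) (x y v u c : V).

Lemma rotation_groupP x : G x <-> exists l, x = orbit l.
Proof.
by split=> [[n [m ->]]|[[n m] ->]]; [exists (n, m) | exists n, m].
Qed.

Lemma rotation_groupB x y : G x -> G y -> G (x - y).
Proof.
move=> /rotation_groupP[l ->] /rotation_groupP[l' ->]; apply/rotation_groupP.
by exists (l - l'); rewrite orbitB.
Qed.

Lemma rotation_groupD x y : G x -> G y -> G (x + y).
Proof.
move=> /rotation_groupP[l ->] /rotation_groupP[l' ->]; apply/rotation_groupP.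
by exists (l + l'); rewrite orbitD.
Qed.

Lemma rotation_group0 : G 0.
Proof. by apply/rotation_groupP; exists 0; rewrite orbit0. Qed.

Lemma translate_translate (A : set V) v u :
  translate (translate A v) u = translate A (u + v).
Proof. by apply/funext => x; rewrite /translate/= opprD addrA. Qed.

Lemma rotation_group_seq L : (forall v, v \in L -> G v) ->
  exists Ls, L = map orbit Ls.
Proof.
elim: L => [|v L IH] LG; first by exists [::].
have [|Ls ->] := IH; first by move=> u uL; apply: LG; rewrite inE uL orbT.
have /rotation_groupP[l ->] := LG v (mem_head _ _).
by exists (l :: Ls).
Qed.

(** Merging parallel generators shortens the sequence, so one may assume that no
generator is a multiple of another one.  Then every generator is the difference
of two vertices, and the translation vector is a vertex minus a sum of
generators. *)
Lemma zono_generators L c : vertices (translate (zono L) c) `<=` G ->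
  exists Ls l, translate (zono L) c = translate (zono (map orbit Ls)) (orbit l).
Proof.
have [k] := ubnP (size L); elim: k L c => // k IH L c; rewrite ltnS => Lk SG.
have [/hasP[v vL /hasP[u uL /sub_rVP[a uE]]]|reduced] :=
  boolP (has (fun v => has (fun u => u <= v)%MS (rem v L)) L).
  have LE : zono L = zono (v :: u :: rem u (rem v L)).
    by rewrite (zono_rem vL) /= (zono_rem uL).
  have sz : (size (rem u (rem v L))).+2 = size L.
    by rewrite (perm_size (perm_to_rem vL)) /= (perm_size (perm_to_rem uL)).
  move: sz LE; set L' := rem u _ => sz LE.
  have [a0|a0] := leP 0 a.
    rewrite LE uE zono_merge_pos// in SG *; apply: IH SG => /=.
    by rewrite sz.
  rewrite LE uE (zono_merge_neg _ _ (ltW a0)) translate_translate in SG *.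
  by apply: IH SG; rewrite /= sz.
have {}reduced v u : v \in L -> u \in rem v L -> ~~ (u <= v)%MS.
  move=> vL uL; apply: contra reduced => uv.
  by apply/hasP; exists v => //; apply/hasP; exists u.
have edge v : v \in L -> exists b, forall s : R, s = 0 \/ s = 1 ->
    G (c + (top b (rem v L) + s *: v)).
  move=> vL; have [b [vb Mb]] := edge_functional (reduced v ^~ vL).
  exists b => s s01; apply: SG; rewrite (zono_rem vL); exact: edge_vertices.
have LG v : v \in L -> G v.
  move=> /edge[b bG].
  have := rotation_groupB (bG 1 (or_intror erefl)) (bG 0 (or_introl erefl)).
  rewrite scale1r scale0r addr0; congr (G _).
  by rewrite [c + (_ + _)]addrA [LHS]addrAC subrr add0r.
have cG : G c.
  have topG b M : {subset M <= L} -> G (top b M).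
    move=> ML; rewrite /top big_seq_cond; elim/big_ind: _ => [||u /andP[/ML /LG]//].
      exact: rotation_group0.
    exact: rotation_groupD.
  case LE : L => [|v L'].
    have cE x : translate (zono L) c x <-> x = c.
      by rewrite LE /translate/=; split=> [/eqP|->]; rewrite ?subrr// subr_eq0 => /eqP.
    by apply: SG; split=> [|x y t /cE -> /cE ->]; first exact/cE.
  have vL : v \in L by rewrite LE mem_head.
  have [b bG] := edge v vL.
  have remL : {subset rem v L <= L} by move=> u; exact: mem_rem.
  have := rotation_groupB (bG 0 (or_introl erefl)) (topG b _ remL).
  by rewrite scale0r addr0 addrK.
have [Ls LsE] := rotation_group_seq LG; have /rotation_groupP[l lE] := cG.
by exists Ls, l; rewrite LsE lE.
Qed.

End lattice_generators.

(** * Volume by slicing *)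

Section slicing.
Context {R : realType}.
Local Notation leb := (@lebesgue_measure R).

Lemma interval_slice (a b : R) :
  (\int[leb]_(t in `[0%R, 1%R[) (\1_(`]a, b]) t)%:E <= (Num.max 0 (b - a))%:E)%E.
Proof.
rewrite integral_indic//=.
rewrite (@le_trans _ _ (leb `]a, b]))//.
  by apply: le_measure => //; rewrite inE//; exact: measurableI.
rewrite lebesgue_measure_itv/= lte_fin; case: ltP => ab.
  by rewrite EFinN -EFinD lee_fin le_max lexx orbT.
by rewrite lee_fin le_max lexx.
Qed.

(** Slices at height [t] turn a weighted cover of the cube by boxes into a weighted
cover of the cube of dimension one less, whose volume is at least 1 by
induction; it remains to integrate over [t].  Weights are what makes the induction
go through: a slice discards the boxes that do not reach height [t], and this must
also make sense in dimension 0, where every box has volume 1. *)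
Lemma cube_slicing (n : nat) (a b : nat -> nat -> R) (c : nat -> R) :
  (forall k, 0 <= c k) ->
  (forall x : nat -> R, (forall i, (i < n)%N -> 0 <= x i < 1) ->
     (1 <= \sum_(k <oo) (c k * \prod_(i < n) (a k i < x i <= b k i)%R%:R)%:E)%E) ->
  (1 <= \sum_(k <oo) (c k * \prod_(i < n) Num.max 0 (b k i - a k i))%:E)%E.
Proof.
elim: n c => [|n IH] c c0 cover.
  apply: (le_trans (cover (fun=> 0) _)) => //; apply: lee_nneseries => [k _ _|k _].
    by rewrite big_ord0 mulr1 lee_fin.
  by rewrite !big_ord0.
pose vol k := \prod_(i < n) Num.max 0 (b k i - a k i).
have vol0 k : 0 <= vol k by apply: prodr_ge0 => i _; rewrite le_max lexx.
have cvol0 k : 0 <= c k * vol k by rewrite mulr_ge0.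
pose f k t := ((c k * vol k)%:E * (\1_(`]a k n, b k n]) t)%:E)%E.
have f0 k t : (0 <= f k t)%E by rewrite /f -EFinM lee_fin mulr_ge0.
have mf k : measurable_fun (`[0%R, 1%R[ : set R) (f k).
  apply: measurable_funeM; apply/measurable_EFinP.
  exact: measurable_indic.
have slices (t : R) : 0 <= t < 1 -> (1 <= \sum_(k <oo) f k t)%E.
  move=> t01.
  have fE k : f k t = (c k * (a k n < t <= b k n)%R%:R * vol k)%:E.
    by rewrite /f -EFinM indicE mem_setE in_itv/= mulrAC.
  rewrite (eq_eseriesr (fun k _ => fE k)); apply: IH; first by move=> k; rewrite mulr_ge0.
  move=> x x01; apply: (le_trans (cover (fun i => if i == n then t else x i) _)).
    move=> i; case: eqVneq => [_ _|ni]; first exact: t01.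
    by rewrite ltnS leq_eqVlt (negPf ni); exact: x01.
  apply: lee_nneseries => [k _ _|k _]; first by rewrite lee_fin mulr_ge0// prodr_ge0.
  rewrite big_ord_recr/= eqxx lee_fin -mulrA [X in _ <= _ * X]mulrC.
  have -> : \prod_(i < n) (a k i < (if i == n :> nat then t else x i) <= b k i)%R%:R =
            \prod_(i < n) (a k i < x i <= b k i)%R%:R :> R.
    by apply: eq_bigr => i _; rewrite ltn_eqF.
  by [].
have : (\int[leb]_(t in `[0%R, 1%R[) 1 <= \int[leb]_(t in `[0%R, 1%R[) \sum_(k <oo) f k t)%E.
  apply: ge0_le_integral => //.
  by apply: (ge0_emeasurable_sum (P := xpredT)) => [k t _ _|k _]; [exact: f0|exact: mf].
rewrite integral_cst//= lebesgue_measure_itv/= lte_fin ltr01 mul1e oppr0 adde0.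
move=> /le_trans; apply; rewrite integral_nneseries//.
apply: lee_nneseries => [k _ _|k _].
  by apply: integral_ge0 => t _; exact: f0.
rewrite /f ge0_integralZl//; last 2 first.
  by apply/measurable_EFinP; exact: measurable_indic.
  by rewrite lee_fin.
rewrite big_ord_recr/= mulrA [leRHS]EFinM.
by apply: lee_wpmul2l; [rewrite lee_fin | exact: interval_slice].
Qed.

End slicing.

(** * Translations, Borel sets and Lebesgue measure *)

Section lebesgue_outer.
Context {R : realType} {d : nat}.
Local Notation V := 'rV[R]_d.+1.
Local Notation mu := (@lebesgue_outer R d).
Local Notation Lmeasurable := mu.-cara.-measurable.
Local Open Scope ereal_scope.
Implicit Types (A B : set V) (v x : V).

Lemma lebesgue_outer_translate A v : mu (translate A v) = mu A.
Proof.
suff le_translate B w : mu (translate B w) <= mu B.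
  apply/eqP; rewrite eq_le le_translate/=.
  rewrite [leLHS](_ : _ = mu (translate (translate A v) (- v)))//.
  congr (mu _); apply/funext => x; rewrite /translate/= opprK addrK//.
apply: le_ereal_inf_tmp => _ [C BC <-]; apply: ereal_inf_lbound.
exists (fun k => ((C k).1 + w, (C k).2 + w)%R).
  move=> x /BC[k _ Ck]; exists k => // i; have := Ck i; rewrite !mxE.
  by rewrite ltrBrDr lerBlDr.
apply: eq_eseriesr => k _; congr EFin; apply: eq_bigr => i _.
by rewrite !mxE opprD addrACA subrr addr0.
Qed.

Lemma measurable_translate A v : Lmeasurable A -> Lmeasurable (translate A v).
Proof.
move=> mA; change (mu.-caratheodory (translate A v)) => X.
have := (mA : mu.-caratheodory A) (translate X (- v)).
have tK B : translate (translate B (- v)) v = B.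
  by apply/funext => x; rewrite /translate/= opprK subrK.
rewrite -[X in X = _ -> _](lebesgue_outer_translate _ v) tK => ->.
rewrite -[X in X + _ = _](lebesgue_outer_translate _ v).
rewrite -[X in _ + X = _](lebesgue_outer_translate _ v).
by congr (mu _ + mu _); apply/funext => x; rewrite /translate/= opprK subrK.
Qed.

Definition clip (f : R -> R) (i : 'I_d.+1) x : V :=
  (\row_j if j == i then f (x 0 j) else x 0 j)%R.

(** A hyperplane orthogonal to an axis cuts each box of a cover into two boxes whose
volumes add up to that of the box. *)
Lemma measurable_halfspace (i : 'I_d.+1) (c : R) : Lmeasurable [set x : V | (x 0 i <= c)%R].
Proof.
change (mu.-caratheodory [set x : V | (x 0 i <= c)%R]).
apply: le_caratheodory_measurable => X.
apply: le_ereal_inf_tmp => _ [C XC <-].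
pose C1 k := ((C k).1, clip (fun t => Num.min t c) i (C k).2).
pose C2 k := (clip (fun t => Num.max t c) i (C k).1, (C k).2).
have C0 (D : nat -> V * V) k : 0 <= (box_volume (D k).1 (D k).2)%:E.
  by rewrite lee_fin box_volume_ge0.
apply: (@le_trans _ _ (\sum_(k <oo) (box_volume (C1 k).1 (C1 k).2)%:E +
                       \sum_(k <oo) (box_volume (C2 k).1 (C2 k).2)%:E)).
  apply: leeD; apply: ereal_inf_lbound.
    exists C1 => // x [/XC[k _ Ck] /= xc]; exists k => // j; have := Ck j.
    rewrite /C1 /clip !mxE; case: eqVneq => [->|//] /andP[-> /=].
    by rewrite le_min => ->.
  exists C2 => // x [/XC[k _ Ck] /= /negP]; rewrite -ltNge => xc.
  exists k => // j; have := Ck j.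
  rewrite /C2 /clip !mxE; case: eqVneq => [->|//].
  by rewrite gt_max => /andP[-> ->]; rewrite xc.
rewrite -nneseriesD; [|by move=> *; exact: C0|by move=> *; exact: C0].
apply: lee_nneseries => [k _ _|k _]; first by rewrite adde_ge0// C0.
rewrite -EFinD lee_fin /box_volume (bigD1 i)//= [X in (_ + X)%R](bigD1 i)//=.
rewrite [leRHS](bigD1 i)//= /clip !mxE eqxx.
have rest (f g : 'I_d.+1 -> R) : (forall j, j != i -> f j = g j) ->
    (\prod_(j < d.+1 | j != i) f j = \prod_(j < d.+1 | j != i) g j)%R.
  by move=> fg; apply: eq_bigr => j; exact: fg.
rewrite (rest _ (fun j => Num.max 0 ((C k).2 0 j - (C k).1 0 j))%R); last first.
  by move=> j ji; rewrite mxE (negPf ji).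
rewrite [X in (_ + _ * X)%R]
  (rest _ (fun j => Num.max 0 ((C k).2 0 j - (C k).1 0 j))%R); last first.
  by move=> j ji; rewrite mxE (negPf ji).
rewrite -mulrDl ler_wpM2r//; first by apply: prodr_ge0 => j _; rewrite le_max lexx.
move: ((C k).1 0 i)%R ((C k).2 0 i)%R => a b; clear.
by rewrite /Num.max /Num.min; do ! case: ifPn; rewrite -?leNgt; lra.
Qed.

Lemma measurable_box a b : Lmeasurable (box a b : set V).
Proof.
have -> : box a b = \bigcap_(i in [set: 'I_d.+1])
    ((~` [set x : V | (x 0 i <= a 0 i)%R]) `&` [set x : V | (x 0 i <= b 0 i)%R]).
  apply/seteqP; split=> x /=.
    by move=> xab i /= _; have /andP[ax xb] := xab i; split=> //=; apply/negP; rewrite -ltNge.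
  by move=> xab i; have [/= /negP + ->] := xab i I; rewrite -ltNge andbT.
apply: fin_bigcap_measurable => // i _; apply: measurableI; last exact: measurable_halfspace.
exact: measurableC (measurable_halfspace _ _).
Qed.

Lemma measurable_open A : open A -> Lmeasurable A.
Proof.
move=> oA.
(* An open set is the union of the boxes with rational corners that it contains. *)
pose Q : set ('rV[rat]_d.+1 * 'rV[rat]_d.+1) :=
  [set q | box (map_mx ratr q.1) (map_mx ratr q.2) `<=` A].
have -> : A = \bigcup_(q in Q) box (map_mx ratr q.1) (map_mx ratr q.2).
  apply/seteqP; split; last by move=> x [q Qq] /Qq.
  move=> x Ax; have /nbhs_ballP[e /= e0 xeA] := open_nbhs_nbhs (conj oA Ax).
  have rat_lt (s t : R) : (s < t)%R -> exists q : rat, (s < ratr q < t)%R.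
    by move=> /rat_in_itvoo[q]; rewrite in_itv/=; exists q.
  have /choice[a aP] (i : 'I_d.+1) : exists q : rat, (x 0 i - e < ratr q < x 0 i)%R.
    by apply: rat_lt; lra.
  have /choice[b bP] (i : 'I_d.+1) : exists q : rat, (x 0 i < ratr q < x 0 i + e)%R.
    by apply: rat_lt; lra.
  exists (\row_i a i, \row_i b i)%R.
    move=> y yab; apply: xeA; split=> // i j; rewrite (ord1 i) /ball/=.
    have := yab j; have := aP j; have := bP j; rewrite !mxE.
    move=> /andP[? ?] /andP[? ?] /andP[? ?]; rewrite ltr_distlC; apply/andP; split; lra.
  move=> i; rewrite !mxE; have /andP[_ ->] := aP i; have /andP[+ _] := bP i.
  exact: ltW.
rewrite bigcup_mkcond; apply: countable_bigcupT_measurable; first exact: countableP.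
by move=> q; case: ifP => _; [exact: measurable_box | exact: measurable0].
Qed.

Lemma measurable_closed A : closed A -> Lmeasurable A.
Proof.
move=> cA; rewrite -(setCK A); apply: measurableC.
by apply: measurable_open; exact: closed_openC.
Qed.

End lebesgue_outer.

(** * Null sets *)

Section null_sets.
Context {R : realType} {d : nat}.
Local Notation V := 'rV[R]_d.+1.
Local Notation mu := (@lebesgue_outer R d).
Local Notation Lmeasurable := mu.-cara.-measurable.
Local Open Scope ereal_scope.
Implicit Types (A B : set V) (v x : V).

Lemma outer_box_le (a b : V) : mu (box a b) <= (box_volume a b)%:E.
Proof.
apply: ereal_inf_lbound; exists (fun k => if k == 0%N then (a, b) else (0, 0)%R).
  by move=> x xab; exists 0%N.
rewrite nneseries_recl//= => [|k _]; last by rewrite lee_fin box_volume_ge0.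
rewrite eseries0 ?adde0// => k k0 _; rewrite -(prednK k0) /=.
by rewrite /box_volume big_ord_recl mxE subrr maxxx mul0r.
Qed.

Lemma bounded_by_box (r : R) A : bounded_by r A ->
  A `<=` box (const_mx (- r - 1))%R (const_mx r).
Proof.
move=> Ar x /Ar xr i; rewrite !mxE; have := le_trans (rV_coord_le x i) xr.
by rewrite ler_norml => /andP[? ->]; rewrite andbT; lra.
Qed.

Lemma bounded_finite_measure (r : R) A : bounded_by r A -> mu A < +oo.
Proof.
move=> /bounded_by_box/le_lebesgue_outer/le_lt_trans; apply.
exact: (le_lt_trans (outer_box_le _ _) (ltry _)).
Qed.

Lemma bigcup_null (F : nat -> set V) : (forall k, mu (F k) = 0) -> mu (\bigcup_k F k) = 0.
Proof.
move=> F0; apply/eqP; rewrite eq_le lebesgue_outer_ge0 andbT.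
by rewrite (le_trans (lebesgue_outer_sigma_subadditive F))// eseries0.
Qed.

Lemma sub_null A B : A `<=` B -> mu B = 0 -> mu A = 0.
Proof.
by move=> /le_lebesgue_outer AB B0; apply/eqP; rewrite eq_le lebesgue_outer_ge0 -B0 AB.
Qed.

Lemma continuous_linear_functional (b : 'cV[R]_d.+1) :
  continuous (fun x : V => (x *m b) 0 0)%R.
Proof.
have -> : (fun x : V => (x *m b) 0 0)%R = (fun x => \sum_i x 0 i * b i 0)%R.
  by apply/funext => x; rewrite mxE.
elim: (index_enum _) => [|i r IH].
  rewrite (_ : (fun _ => _) = cst 0%R); first exact: cst_continuous.
  by apply/funext => y; rewrite big_nil.
rewrite (_ : (fun _ => _) =
  (fun y : V => y 0 i * b i 0) \+ (fun y : V => \sum_(i <- r) y 0 i * b i 0))%R.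
  move=> x; apply: (@continuousD _ _ _ (fun y : V => y 0 i * b i 0)%R); last exact: IH.
  apply: (@continuousM _ _ (fun y : V => y 0 i)%R (cst (b i 0)%R)).
    exact: coord_continuous.
  exact: cst_continuous.
by apply/funext => y; rewrite big_cons.
Qed.

(** A bounded piece [A] of the hyperplane has infinitely many disjoint translates, by
[u / (j + 1)], inside a bounded set, so its measure must be 0. *)
Lemma hyperplane_null (b : 'cV[R]_d.+1) (u : V) : ((u *m b) 0 0 = 1)%R ->
  mu [set x | (x *m b) 0 0 = 0]%R = 0.
Proof.
move=> ub; set H := [set x | _].
pose psi x : R := ((x *m b) 0 0)%R.
have mH : Lmeasurable H.
  apply: measurable_closed; apply: (@preimage_closed _ _ psi [set x | x = 0%R]).
    by move=> x _; exact: continuous_linear_functional.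
  exact: closed_eq.
have HE : H `<=` \bigcup_(k : nat) (H `&` box (const_mx (- k%:R))%R (const_mx k%:R)).
  move=> x Hx; exists (Num.truncn `|x|%R).+2 => //; split=> // i; rewrite !mxE.
  have := rV_coord_le x i; have := truncnS_gt `|x|%R.
  by rewrite ler_norml -natr1 => ? /andP[? ?]; apply/andP; split; lra.
apply: (sub_null HE); apply: bigcup_null => k; set A := H `&` _.
have mA : Lmeasurable A by apply: measurableI => //; exact: measurable_box.
pose T (j : nat) := translate A (j.+1%:R^-1 *: u)%R.
have mT j : Lmeasurable (T j) by exact: measurable_translate.
have psiT j x : T j x -> psi x = (j.+1%:R^-1)%R.
  case=> /eqP; rewrite mulmxBl mxE [X in (_ + X)%R]mxE subr_eq0 => /eqP + _.
  by rewrite /psi => ->; rewrite -scalemxAl mxE ub mulr1.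
have tT : trivIset setT T.
  move=> i j _ _ [x [/psiT + /psiT]] => -> /invr_inj /eqP.
  by rewrite eqr_nat eqSS => /eqP.
pose K := (k%:R + `|u| + 1)%R.
have TK : bounded_by K (\bigcup_j T j).
  move=> x [j _ [_ xk]]; apply/rV_norm_le; first by rewrite /K addr_ge0// addr_ge0.
  have ju i : (`|j.+1%:R^-1 * u 0 i| <= `|u|)%R.
    rewrite normrM ger0_norm ?invr_ge0// (le_trans _ (rV_coord_le u i))//.
    by rewrite ler_piMl// invf_le1// ler1n.
  move=> i; have := xk i; rewrite !mxE; have := ju i.
  rewrite /K !ler_norml => /andP[a1 a2] /andP[a3 a4].
  have widen (p q s t : R) : (- t <= p -> p <= t -> - q < s - p -> s - p <= q ->
      - (q + t + 1) <= s <= q + t + 1)%R by move=> *; apply/andP; split; lra.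
  exact: widen a1 a2 a3 a4.
have finA : mu A < +oo.
  apply: (@bounded_finite_measure K) => x [_ xk]; apply/rV_norm_le.
    by rewrite /K addr_ge0// addr_ge0.
  move=> i; have := xk i; rewrite !mxE; have := normr_ge0 u.
  by rewrite /K ler_norml => ? /andP[? ?]; apply/andP; split; lra.
have finK := bounded_finite_measure TK.
have AE : mu A = (fine (mu A))%:E by rewrite fineK// ge0_fin_numE// lebesgue_outer_ge0.
have UE : mu (\bigcup_j T j) = (fine (mu (\bigcup_j T j)))%:E.
  by rewrite fineK// ge0_fin_numE// lebesgue_outer_ge0.
have copies n : (n%:R * fine (mu A) <= fine (mu (\bigcup_j T j)))%R.
  rewrite mulr_natl -lee_fin -UE.
  have := @measure_bigsetU _ _ _ (@mes R d) T (fun j => mT j) tT n.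
  rewrite (eq_bigr (fun=> (fine (mu A))%:E)); last first.
    by move=> j _; rewrite -AE; exact: lebesgue_outer_translate.
  rewrite sumEFin sumr_const card_ord => <-.
  by apply: le_lebesgue_outer; exact: bigsetU_bigcup.
have A0 : (0 <= fine (mu A))%R by rewrite fine_ge0// lebesgue_outer_ge0.
rewrite AE; congr EFin; apply/eqP; rewrite eq_le A0 andbT leNgt; apply/negP => Agt0.
have := copies (Num.truncn (fine (mu (\bigcup_j T j)) / fine (mu A))).+1.
by rewrite -ler_pdivlMr// leNgt truncnS_gt.
Qed.

Lemma negligible_mes A : mu A = 0 -> (@mes R d).-negligible A.
Proof.
move=> A0; exists A; split=> //.
change (mu.-caratheodory A); apply: le_caratheodory_measurable => X.
have XA0 : mu (X `&` A) = 0 by apply: (@sub_null _ A) => // x [].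
change (mu (X `&` A) + mu (X `&` ~` A) <= mu X).
by rewrite XA0 add0e le_lebesgue_outer// => x [].
Qed.

(** Finite sequences of pairs are countable, and each proper subspace lies in a
hyperplane. *)
Lemma nongeneric_null (alpha : V) : mu [set y | ~ generic alpha y] = 0.
Proof.
pose T := (seq (int * 'rV[int]_d.+1) * (int * 'rV[int]_d.+1))%type.
pose F (k : nat) : set V := if (choice.unpickle k : option T) is Some Jl
  then [set y | ~~ row_full (span_of alpha Jl.1) /\
                ((y + orbit alpha Jl.2)%R <= span_of alpha Jl.1)%MS] else set0.
apply: (@sub_null _ (\bigcup_k F k)).
  move=> y /= /existsNP[J /existsNP[l /not_implyP[Jfull /negP/negPn Jy]]].
  by exists (choice.pickle (J, l)) => //; rewrite /F choice.pickleK.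
apply: bigcup_null => k; rewrite /F; case: choice.unpickle => [[J l]|];
  last exact: lebesgue_outer0.
have [->|/set0P[y0 /= [Jfull _]]] := eqVneq [set y | ~~ row_full (span_of alpha J) /\
   ((y + orbit alpha l)%R <= span_of alpha J)%MS] set0; first exact: lebesgue_outer0.
have [i iJ] : exists i, ~~ (row i 1%:M <= span_of alpha J)%MS.
  by apply/row_subPn; rewrite sub1mx.
have [b [Jb ib]] := separating_functional iJ.
apply: (@sub_null _ (translate [set x | (x *m b) 0 0 = 0]%R (- orbit alpha l))).
  by move=> y /= [_ /submxP[D yE]]; rewrite /translate/= opprK yE -mulmxA Jb mulmx0 mxE.
by rewrite lebesgue_outer_translate; exact: hyperplane_null ib.
Qed.

End null_sets.

(** * Averaging over the torus *)

Section averaging.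
Context {R : realType} {d : nat}.
Local Notation V := 'rV[R]_d.+1.
Local Notation mu := (@lebesgue_outer R d).
Local Notation mes := (@mes R d).
Local Notation Lmeasurable := mu.-cara.-measurable.
Local Notation cube := (@unit_cube R d).
Local Open Scope ereal_scope.
Implicit Types (A S : set V) (v x : V).

Lemma measurable_unit_cube : Lmeasurable cube.
Proof.
have closed_slab (c : R) i : closed [set x : V | (c <= x 0 i)%R].
  apply: (@preimage_closed _ _ (fun x : V => (x 0 i)%R) [set t | (c <= t)%R]).
    by move=> x _; exact: coord_continuous.
  exact: closed_ge.
have -> : cube = \bigcap_(i in [set: 'I_d.+1])
    ([set x : V | (0 <= x 0 i)%R] `&` ~` [set x : V | (1 <= x 0 i)%R]).
  apply/seteqP; split=> x /=.
    by move=> x01 i /= _; have /andP[x0 x1] := x01 i; split=> //=; apply/negP; rewrite -ltNge.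
  by move=> x01 i; have [/= -> /negP] := x01 i I; rewrite -ltNge.
apply: fin_bigcap_measurable => // i _; apply: measurableI.
  exact: measurable_closed.
exact: measurableC (measurable_closed (closed_slab _ _)).
Qed.

Lemma outer_unit_cube_ge1 : 1 <= mu cube.
Proof.
apply: le_ereal_inf_tmp => _ [C cubeC <-].
pose a k i := ((C k).1 0 (inord i))%R; pose b k i := ((C k).2 0 (inord i))%R.
have := @cube_slicing R d.+1 a b (fun=> 1%R) (fun=> ler01).
have volE k : (1 * \prod_(i < d.+1) Num.max 0 (b k i - a k i))%R = box_volume (C k).1 (C k).2.
  by rewrite mul1r; apply: eq_bigr => i _; rewrite /a /b inord_val.
under eq_eseriesr do rewrite volE; apply.
move=> x x01; have [|k _ Ck] := cubeC (\row_(i < d.+1) x i)%R.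
  by move=> i; rewrite mxE; exact: x01.
have term0 j : 0 <= (1 * \prod_(i < d.+1) (a j i < x i <= b j i)%R%:R)%:E :> \bar R.
  by rewrite lee_fin mul1r prodr_ge0.
apply: le_trans (nneseries_lim_ge k.+1 (fun j _ _ => term0 j)).
rewrite big_nat_recr//= -[leLHS]add0e; apply: leeD; first by apply: sume_ge0 => j _.
rewrite lee_fin mul1r big1// => i _; have := Ck i.
by rewrite !mxE /a /b inord_val => ->.
Qed.

(** The cube and the half-open box of the same side differ on the coordinate
hyperplanes only, hence the upper bound. *)
Lemma outer_unit_cube : mu cube = 1.
Proof.
apply/eqP; rewrite eq_le outer_unit_cube_ge1 andbT.
pose H (i : 'I_d.+1) : set V := [set x | (x *m (delta_mx i 0 : 'cV[R]_d.+1)) 0 0 = 0]%R.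
pose F (k : nat) : set V := if (insub k : option 'I_d.+1) is Some i then H i else set0.
have H0 i : mu (H i) = 0.
  have := @hyperplane_null R d (delta_mx i 0)%R (delta_mx 0 i)%R; rewrite /H; apply.
  by rewrite mul_delta_mx mxE !eqxx.
have F0 : mu (\bigcup_k F k) = 0.
  apply: bigcup_null => k; rewrite /F; case: insubP => [i _ _|_]; first exact: H0.
  exact: lebesgue_outer0.
have sub : cube `<=` \bigcup_k F k `|` (box 0 (const_mx 1%R) : set V).
  move=> x x01; have [[i xi]|x_neq0] := pselect (exists i, x 0 i = 0)%R; [left|right].
    by exists i => //; rewrite /F valK /H/= -colE mxE.
  move=> i; rewrite !mxE; have /andP[x0 /ltW ->] := x01 i; rewrite andbT lt_neqAle x0 andbT.
  by apply/eqP => xi; apply: x_neq0; exists i.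
apply: (le_trans (le_lebesgue_outer sub)).
apply: (le_trans (outer_measureU2 mu _ _)).
have -> : 1 = 0 + (box_volume (0%R : V) (const_mx 1%R))%:E :> \bar R.
  rewrite add0e; congr EFin; rewrite /box_volume big1// => i _.
  by rewrite !mxE subr0; apply/max_idPr; exact: ler01.
by apply: leeD; [rewrite -F0 | exact: outer_box_le].
Qed.

Lemma chi_size A x : finite_set (slice A x) -> chi A x = (ncard (slice A x))%:R%R.
Proof.
move=> fA; rewrite /chi -(fsbig_widen (slice A x))//; last first.
  by move=> m [_ nm]; rewrite /= indicE memNset.
rewrite fsbig_finite// big_seq (eq_bigr (fun=> 1%R)).
  by rewrite -big_seq big_const_seq count_predT iter_addr_0.
by move=> m; rewrite in_fset_set// inE indicE => Am; rewrite mem_set.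
Qed.

(** On the unit cube the same finitely many integer translates contribute, which
makes the periodisation integrable term by term. *)
Lemma chi_finite_sum (r : R) S : bounded_by r S -> exists F : {fset 'rV[int]_d.+1},
  (forall m x, cube x -> S (x + intv R m)%R -> m \in F) /\
  (forall x, cube x -> chi S x = (\sum_(m <- F) \1_S (x + intv R m)%R)%R).
Proof.
move=> Sr; pose N := (Num.truncn (r + 1)%R).+1.
pose F : set 'rV[int]_d.+1 := [set m | forall i, (`|m 0 i| <= N%:Z)%R].
have fF : finite_set F := finite_bounded_int N.
have SF m x : cube x -> S (x + intv R m)%R -> F m.
  move=> x01 /Sr xm i; have := le_trans (rV_coord_le _ i) xm; rewrite !mxE.
  have /andP[x0 x1] := x01 i; have := truncnS_gt (r + 1)%R; rewrite -/N => N1.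
  rewrite -(ler_int R) intr_norm -[(N%:Z)%:~R%R]pmulrn !ler_norml => /andP[? ?].
  by apply/andP; split; lra.
exists (fset_set F); split=> [m x x01 Sm|x x01].
  by rewrite in_fset_set// inE; exact: SF Sm.
rewrite /chi -fsbig_finite//; apply/esym/fsbig_widen => // m [_ /= nFm].
by rewrite indicE memNset// => Sm; apply: nFm; exact: SF Sm.
Qed.

Lemma indic_translate A x v : \1_A (x + v)%R = \1_(translate A (- v)) x :> R.
Proof.
rewrite !indicE; congr (_%:R)%R; congr nat_of_bool.
by apply/idP/idP; rewrite !inE /translate/= opprK.
Qed.

Lemma measurable_indic_translate (D : set (caratheodory_type mu)) S v :
  Lmeasurable S -> measurable_fun D (fun x : caratheodory_type mu => (\1_S (x + v)%R : R)%:E).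
Proof.
move=> mS; apply/measurable_EFinP.
rewrite (_ : (fun _ => _) = \1_(translate S (- v)) :> (caratheodory_type mu -> R)).
  by apply: measurable_indic; exact: measurable_translate.
by apply/funext => x; exact: indic_translate.
Qed.

Lemma measurable_chi (r : R) S : bounded_by r S -> Lmeasurable S ->
  measurable_fun (cube : set (caratheodory_type mu)) (fun x => (chi S x)%:E).
Proof.
move=> /chi_finite_sum[F [_ chiE]] mS.
apply: (eq_measurable_fun (fun x : caratheodory_type mu =>
  \sum_(m <- F) (\1_S (x + intv R m)%R : R)%:E)).
  by move=> x; rewrite inE => x01; rewrite chiE// sumEFin.
by apply: emeasurable_sum => m; exact: measurable_indic_translate.
Qed.

(** The integer translates of the unit cube partition the space. *)
Lemma integral_chi (r : R) S : bounded_by r S -> Lmeasurable S ->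
  \int[mes]_(x in cube) (chi S x)%:E = mes S.
Proof.
move=> Sr mS; have [F [SF chiE]] := chi_finite_sum Sr.
have mcube := measurable_unit_cube.
rewrite (eq_integral (fun x : caratheodory_type mu =>
  \sum_(m <- F) (\1_S (x + intv R m)%R : R)%:E)); last first.
  by move=> x; rewrite inE => x01; rewrite chiE// sumEFin.
rewrite ge0_integral_sum//; last first.
  by move=> m; exact: measurable_indic_translate.
pose T m := S `&` translate cube (intv R m).
have mT m : Lmeasurable (T m) by apply: measurableI => //; exact: measurable_translate.
rewrite (eq_bigr (fun m => mes (T m))); last first.
  move=> m _; rewrite (eq_integral (fun x : caratheodory_type mu =>
    (\1_(translate S (- intv R m)) x : R)%:E)); last first.
    by move=> x _; rewrite indic_translate.
  rewrite integral_indic//; last exact: measurable_translate.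
  rewrite -[LHS](lebesgue_outer_translate _ (intv R m)); congr (mes _).
  by apply/funext => x; rewrite /T /translate/= opprK subrK.
have trivT : trivIset [set` F] T.
  move=> m m' _ _ [x [[_ xm] [_ xm']]]; apply/rowP => i.
  have := xm i; have := xm' i; rewrite !mxE => /andP[? ?] /andP[? ?].
  have : (`|(m 0 i - m' 0 i)%:~R : R| < 1%:~R)%R.
    by rewrite rmorphB/= ltr_norml; apply/andP; split; lra.
  by rewrite -intr_norm ltr_int; move: (m 0%R i) (m' 0%R i) => a b; lia.
have := @measure_fin_bigcup _ _ _ mes _ [set` F] T (finite_fset F) trivT (fun m _ => mT m).
rewrite fsbig_finite// set_fsetK => <-; congr (mes _).
apply/seteqP; split=> [x [m _ []]//|x Sx].
pose m : 'rV[int]_d.+1 := (\row_i Num.floor (x 0 i))%R.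
have xm : cube (x - intv R m)%R.
  move=> i; rewrite !mxE; have := floor_itv (x 0%R i); rewrite rmorphD/= => /andP[? ?].
  by apply/andP; split; lra.
by exists m => //=; apply: (SF _ _ xm); rewrite subrK.
Qed.

(** For generic [x], the count from [x] differs by at most [C] from the count from
almost every [y]; the integral over [y] in the unit cube of the latter is
[n * mes S]. *)
Lemma steady_bounded_remainder (alpha : V) (r : R) S : bounded_set S ->
  bounded_by r S -> Lmeasurable S -> steady alpha (visits alpha S) ->
  bounded_remainder_set alpha S.
Proof.
move=> bS Sr mS [C SC]; split=> //; exists C%:R%R => n n0.
have [K tS] := bounded_thin Sr.
pose B x : R := (\sum_(0 <= k < n) chi S (x + k%:R *: alpha))%R.
have BE x : B x = (visits alpha S n x)%:R%R.
  rewrite /B /visits natr_sum; apply: eq_bigr => k _.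
  by apply: chi_size; have [] := tS (x + k%:R *: alpha)%R.
pose Sk (k : nat) := translate S (- (k%:R *: alpha))%R.
have chiSk k x : chi S (x + k%:R *: alpha)%R = chi (Sk k) x.
  rewrite /chi; apply: eq_fsbigr => m _; rewrite -addrA [(_ *: _ + _)%R]addrC addrA.
  exact: indic_translate.
have SkB k : bounded_by (r + k%:R * `|alpha|)%R (Sk k).
  move=> x; rewrite /Sk/translate/= opprK => /Sr xr.
  rewrite -(addrK (k%:R *: alpha)%R x) (le_trans (ler_normB _ _))// lerD//.
  by rewrite normrZ normr_nat.
have mSk k : Lmeasurable (Sk k) by exact: measurable_translate.
have mB : measurable_fun (cube : set (caratheodory_type mu)) (fun x => (B x)%:E).
  rewrite (_ : (fun _ => _) = (fun x : caratheodory_type mu =>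
    \sum_(k <- index_iota 0 n) (chi (Sk k) x)%:E)).
    by apply: emeasurable_sum => k; exact: measurable_chi (SkB k) (mSk k).
  by apply/funext => x; rewrite /B -sumEFin; apply: eq_bigr => k _; rewrite chiSk.
have finS : mes S = (fine (mes S))%:E.
  by rewrite fineK// ge0_fin_numE ?(bounded_finite_measure Sr)//; exact: lebesgue_outer_ge0.
have intB : \int[mes]_(x in cube) (B x)%:E = (n%:R * fine (mes S))%:E.
  rewrite (eq_integral (fun x : caratheodory_type mu =>
    \sum_(k <- index_iota 0 n) (chi (Sk k) x)%:E)); last first.
    by move=> x _; rewrite /B -sumEFin; apply: eq_bigr => k _; rewrite chiSk.
  have chi0 k x : (0 <= (chi (Sk k) x)%:E :> \bar R).
    by rewrite lee_fin; apply: fsumr_ge0 => m _; rewrite indicE.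
  rewrite ge0_integral_sum//; last 2 first.
  - exact: measurable_unit_cube.
  - by move=> k; exact: measurable_chi (SkB k) (mSk k).
  rewrite (eq_bigr (fun=> (fine (mes S))%:E)) => [|k _].
    by rewrite sumEFin big_const_seq count_predT size_iota subn0 iter_addr_0 mulr_natl.
  by rewrite (integral_chi (SkB k) (mSk k)) -finS; exact: lebesgue_outer_translate.
have B0 x : (0 <= B x)%R by rewrite BE.
have aeF : Filter (almost_everywhere (mes : {measure set (caratheodory_type mu) -> \bar R})).
  exact: ae_filter_ringOfSetsType.
have aeG : {ae mes, forall x, generic alpha x}.
  by apply: negligible_mes; exact: nongeneric_null.
apply: (filterS _ aeG) => x gx _; rewrite -/(B x).
have int_cst (c : R) : \int[mes]_(_ in cube) c%:E = c%:E.
  rewrite integral_cst; last exact: measurable_unit_cube.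
  by rewrite -[RHS]mule1; congr (_ * _); exact: outer_unit_cube.
have mcst (c : R) : measurable_fun (cube : set (caratheodory_type mu)) (fun=> c%:E) by [].
have BC y : generic alpha y -> (B x <= B y + C%:R)%R /\ (B y <= B x + C%:R)%R.
  by move=> gy; rewrite !BE -!natrD !ler_nat; split; exact: SC.
have aeB : {ae mes, forall y, cube y -> (B y)%:E <= (B x + C%:R)%:E}.
  by apply: (filterS _ aeG) => y /BC[_ +] _; rewrite lee_fin.
have aeB' : {ae mes, forall y, cube y -> (B x)%:E <= (B y)%:E + C%:R%:E}.
  by apply: (filterS _ aeG) => y /BC[+ _] _; rewrite -EFinD lee_fin.
have upper : (n%:R * fine (mes S))%:E <= (B x + C%:R)%:E.
  rewrite -intB -[leRHS]int_cst; apply: ae_ge0_le_integral => //.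
  - exact: measurable_unit_cube.
  - by move=> y _; rewrite lee_fin.
  - by move=> y _; rewrite lee_fin addr_ge0.
have lower : (B x)%:E <= (n%:R * fine (mes S))%:E + C%:R%:E.
  rewrite -intB -[leLHS]int_cst -[X in _ + X]int_cst -ge0_integralD//; last 2 first.
  - exact: measurable_unit_cube.
  - by move=> y _; rewrite lee_fin.
  apply: ae_ge0_le_integral => //.
  - exact: measurable_unit_cube.
  - by move=> y _; rewrite lee_fin.
  - by move=> y _; rewrite -EFinD lee_fin addr_ge0.
  - exact: emeasurable_funD.
move: upper lower; rewrite -EFinD !lee_fin => upper lower.
by rewrite ler_norml; apply/andP; split; lra.
Qed.

End averaging.

(** * Convex hulls of finite sequences *)

Section hulls.
Context {R : realType} {E : lmodType R}.
Implicit Types (A : set E) (L : seq E) (x y z p : E).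

Lemma convex_setE A : @convex_set R E A <-> forall x y (t : R), 0 <= t <= 1 ->
  A x -> A y -> A (t *: x + (1 - t) *: y).
Proof.
split=> [cA x y t /andP[t0 t1] Ax Ay|cA x y t]; last first.
  by rewrite !inE => Ax Ay; apply: cA => //; rewrite ge0 le1.
by have := cA x y (Itv01 t0 t1); rewrite !inE; apply.
Qed.

Definition hull L : set E := convex_hull [set` L].

Lemma hull_convex L x y (t : R) : 0 <= t <= 1 ->
  hull L x -> hull L y -> hull L (t *: x + (1 - t) *: y).
Proof.
move=> t01 Lx Ly A [cA LA]; have /convex_setE := cA; apply=> //.
  exact: Lx.
exact: Ly.
Qed.

Lemma mem_hull L x : x \in L -> hull L x.
Proof. by move=> xL A [_]; apply. Qed.

Lemma hull_min L A : (forall x y (t : R), 0 <= t <= 1 -> A x -> A y ->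
  A (t *: x + (1 - t) *: y)) -> (forall x, x \in L -> A x) -> hull L `<=` A.
Proof. by move=> cA LA x; apply; split=> //; exact/convex_setE. Qed.

Lemma hull_mono L L' : (forall x, x \in L -> hull L' x) -> hull L `<=` hull L'.
Proof. by apply: hull_min; exact: hull_convex. Qed.

Lemma hull_nil : hull [::] = set0.
Proof. by rewrite -subset0; apply: hull_min. Qed.

(** Adding one point to a finite set joins it by segments to the hull of the others.
The first alternative also covers the case of an empty hull. *)
Lemma hull_cons p L z : hull (p :: L) z <-> z = p \/
  exists2 t : R, 0 <= t <= 1 & exists2 y, hull L y & z = (1 - t) *: p + t *: y.
Proof.
split; last first.
  case=> [->|[t t01 [y Ly ->]]]; first by apply: mem_hull; rewrite mem_head.
  rewrite addrC; apply: hull_convex => //; last by apply: mem_hull; rewrite mem_head.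
  by apply: hull_mono Ly => x xL; apply: mem_hull; rewrite inE xL orbT.
pose A z := exists2 t : R, 0 <= t <= 1 &
  exists y, [/\ t = 0 \/ hull L y, (forall q, hull L q -> hull L y) & z = (1 - t) *: p + t *: y].
suff : hull (p :: L) `<=` A.
  move=> /[apply] -[t t01 [y [[t0|Ly] _ zE]]]; last by right; exists t => //; exists y.
  by left; rewrite zE t0 subr0 scale1r scale0r addr0.
have Ap : A p.
  have [[q Lq]|nL] := pselect (exists q, hull L q).
    exists 0; first by rewrite lexx ler01.
    by exists q; split=> //; [left|rewrite subr0 scale1r scale0r addr0].
  exists 0; first by rewrite lexx ler01.
  exists p; split; [by left|by move=> q Lq; case: nL; exists q|].
  by rewrite subr0 scale1r scale0r addr0.
apply: hull_min => [x y s /andP[s0 s1]|x]; last first.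
  rewrite inE => /predU1P[->//|xL].
  exists 1; first by rewrite lexx ler01.
  by exists x; have := mem_hull xL; split=> //; [right|rewrite subrr scale0r add0r scale1r].
move=> [t /andP[t0 t1] [x' [tx Lx' ->]]] [u /andP[u0 u1] [y' [uy Ly' ->]]].
pose w := s * t + (1 - s) * u.
have w0 : 0 <= w by rewrite addr_ge0// mulr_ge0// subr_ge0.
have w1 : w <= 1 by rewrite /w; nra.
have st0 : 0 <= s * t by rewrite mulr_ge0.
have su0 : 0 <= (1 - s) * u by rewrite mulr_ge0// subr_ge0.
have mixE : s *: ((1 - t) *: p + t *: x') + (1 - s) *: ((1 - u) *: p + u *: y') =
    (1 - w) *: p + ((s * t) *: x' + ((1 - s) * u) *: y').
  rewrite !scalerDr !scalerA addrACA -scalerDl; congr (_ *: p + _).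
  by rewrite /w; ring.
rewrite mixE.
have [w_eq0|w_neq0] := eqVneq w 0.
  have [-> ->] : s * t = 0 /\ (1 - s) * u = 0 by rewrite /w in w_eq0; split; lra.
  by rewrite w_eq0 subr0 !scale0r !addr0 scale1r.
exists w; first by rewrite w0 w1.
exists ((s * t / w) *: x' + (1 - s * t / w) *: y'); split.
- right; apply: hull_convex.
  + rewrite divr_ge0//= ler_pdivrMr ?lt_def ?w_neq0 ?w0// mul1r /w; lra.
  + case: tx => // t_eq0; apply: Lx'.
    case: uy => [u_eq0|]; last by apply.
    by move: w_neq0; rewrite /w t_eq0 u_eq0 !mulr0 addr0 eqxx.
  + case: uy => // u_eq0; apply: Ly'.
    case: tx => [t_eq0|]; last by apply.
    by move: w_neq0; rewrite /w t_eq0 u_eq0 !mulr0 addr0 eqxx.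
- move=> q Lq; apply: hull_convex; [|exact: Lx' Lq|exact: Ly' Lq].
  by rewrite divr_ge0//= ler_pdivrMr ?lt_def ?w_neq0 ?w0// mul1r /w; lra.
congr (_ + _); rewrite scalerDr !scalerA mulrBr mulr1 [w * _]mulrC divfK//.
by congr (_ + _ *: _); rewrite /w; ring.
Qed.

End hulls.

(** * Zonotopes are bounded remainder sets *)

Section polytopes.
Context {R : realType} {d : nat}.
Local Notation V := 'rV[R]_d.+1.
Implicit Types (S : set V) (L : seq V) (x y p : V).

(** By [hull_cons], adding a point takes the image of a product of compact sets under a
continuous map. *)
Lemma hull_compact L : compact (hull L).
Proof.
elim: L => [|p L IH]; first by rewrite hull_nil; exact: compact0.
pose f (z : R * V) : V := (1 - z.1) *: p + z.1 *: z.2.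
have -> : hull (p :: L) = [set p] `|` f @` (`[0, 1] `*` hull L).
  apply/seteqP; split=> [z /hull_cons[->|[t t01 [y Ly ->]]]|z [->|[[t y] [/= t01 Ly] <-]]].
  - by left.
  - by right; exists (t, y); split=> //=; rewrite in_itv.
  - by apply: mem_hull; rewrite mem_head.
  apply/hull_cons; right; exists t; first by rewrite in_itv in t01.
  by exists y.
apply: compactU; first exact: compact_set1.
apply: continuous_compact; last by apply: compact_setX => //; exact: segment_compact.
apply: continuous_subspaceT => z; apply: cvgD; last first.
  by apply: cvgZ; [exact: cvg_fst|exact: cvg_snd].
apply: cvgZ; last exact: cvg_cst.
by apply: cvgB; [exact: cvg_cst|exact: cvg_fst].
Qed.

Lemma polytope_hull S : convex_polytope S -> exists L, S = hull L.
Proof. by move=> [X /finite_seqP[L ->] ->]; exists L. Qed.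

Lemma polytope_compact S : convex_polytope S -> compact S.
Proof. by move=> /polytope_hull[L ->]; exact: hull_compact. Qed.

Lemma bounded_set_by S : bounded_set S -> exists r, bounded_by r S.
Proof.
move=> [M [_ SM]]; exists (M + 1) => x Sx.
by apply: (SM (M + 1)) => //; rewrite ltrDl.
Qed.

Lemma polytope_bounded_remainder (alpha : V) S : convex_polytope S ->
  steady alpha (visits alpha S) -> bounded_remainder_set alpha S.
Proof.
move=> /polytope_compact cS Ssteady; have bS := compact_bounded cS.
have [r Sr] := bounded_set_by bS.
apply: (steady_bounded_remainder bS Sr) => //.
by apply: measurable_closed; apply: compact_closed => //; exact: norm_hausdorff.
Qed.

(** Each segment [[a, b]] is the translate by [a] of [[0, b - a]]. *)
Lemma minkowski_zono m (a b : 'I_m -> V) : exists L c,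
  minkowski_sum (fun i => segment (a i) (b i)) = translate (zono L) c.
Proof.
elim: m a b => [|m IH] a b.
  exists [::], 0; apply/seteqP; split=> x; rewrite /translate/= subr0.
    by case=> s _ <-; rewrite big_ord0.
  move=> ->; exists (fun i => a i); last by rewrite big_ord0.
  by case.
have [L [c Lc]] := IH (a \o lift ord0) (b \o lift ord0).
exists ((b ord0 - a ord0) :: L), (a ord0 + c).
apply/seteqP; split=> x.
  case=> s sab <-; rewrite big_ord_recl /translate/=.
  have : translate (zono L) c (\sum_(i < m) s (lift ord0 i)).
    by rewrite -Lc; exists (s \o lift ord0) => // i; exact: sab.
  have [t t01 <-] := sab ord0; rewrite /translate/= => sL.
  exists t; first by move: t01; rewrite /= in_itv.
  move: sL; congr (zono L); move: (\sum_(_ < _) _) => w.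
  by apply/rowP => i; rewrite !mxE; ring.
rewrite /translate/= => -[t t01 xL].
have {}Lc : minkowski_sum (fun i : 'I_m => segment (a (lift ord0 i)) (b (lift ord0 i))) =
  translate (zono L) c := Lc.
have : minkowski_sum (fun i : 'I_m => segment (a (lift ord0 i)) (b (lift ord0 i)))
    (x - a ord0 - t *: (b ord0 - a ord0)).
  by move: xL; rewrite Lc; congr (zono L); apply/rowP => i; rewrite !mxE; ring.
case=> s sab sE.
exists (fun i => if unlift ord0 i is Some j then s j else x - \sum_(i < m) s i).
  move=> i; case: unliftP => [j ->|->]; first exact: sab.
  exists t; first by rewrite /= in_itv.
  by rewrite sE; apply/rowP => k; rewrite !mxE; ring.
rewrite big_ord_recl unlift_none.
have -> : \sum_(i < m) (if unlift ord0 (lift ord0 i) is Some j then s j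
    else x - \sum_(i < m) s i) = \sum_(i < m) s i.
  by apply: eq_bigr => i _; rewrite liftK.
exact: subrK.
Qed.

Lemma zonotope_bounded_remainder (alpha : V) S : zonotope S ->
  vertices S `<=` rotation_group alpha -> bounded_remainder_set alpha S.
Proof.
move=> [polyS [m [a [b SE]]]] SG; apply: polytope_bounded_remainder => //.
have [L [c Lc]] := minkowski_zono a b; rewrite SE Lc in SG *.
by have [Ls [l ->]] := zono_generators SG; exact: zono_steady.
Qed.

End polytopes.

(** * Cutting plane polygons along chords *)

Section plane.
Context {R : realType}.
Local Notation V := 'rV[R]_2.
Implicit Types (L : seq V) (x y z p q r s u v : V).

Definition cross u v : R := u 0 0 * v 0 1 - u 0 1 * v 0 0.

Lemma rV2P x y : x 0 0 = y 0 0 -> x 0 1 = y 0 1 -> x = y.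
Proof.
move=> xy0 xy1; apply/rowP => -[[|[|//]] i2].
  by rewrite [Ordinal _](_ : _ = 0)//; exact: val_inj.
by rewrite [Ordinal _](_ : _ = 1)//; exact: val_inj.
Qed.

Lemma cross_coords u v w : cross u v != 0 ->
  w = (cross w v / cross u v) *: u + (cross u w / cross u v) *: v.
Proof.
by move=> uv; apply: rV2P; rewrite !mxE; move: uv; rewrite /cross => uv; field.
Qed.

Lemma cross_parallel u w : u != 0 -> cross u w = 0 -> exists t : R, w = t *: u.
Proof.
move=> u0 /eqP; rewrite /cross subr_eq0 => /eqP uw.
have [u00|u00] := eqVneq (u 0 0) 0; last first.
  exists (w 0 0 / u 0 0); apply: rV2P; rewrite mxE; first by rewrite divfK.
  by apply: (mulfI u00); rewrite uw; field.
have u01 : u 0 1 != 0.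
  by apply: contra u0 => /eqP u01; apply/eqP/rV2P; rewrite ?u00 ?u01 mxE.
exists (w 0 1 / u 0 1); apply: rV2P; rewrite mxE; last by rewrite divfK.
by apply: (mulfI u01); rewrite -uw u00; ring.
Qed.

Lemma cross_affine u p (t : R) x y :
  cross u (t *: x + (1 - t) *: y - p) = t * cross u (x - p) + (1 - t) * cross u (y - p).
Proof. by rewrite /cross !mxE; ring. Qed.

Lemma cross_collinear p q r : cross (q - p) (r - p) = 0 ->
  exists2 t : R, 0 <= t <= 1 & [\/ p = t *: q + (1 - t) *: r,
    q = t *: p + (1 - t) *: r | r = t *: p + (1 - t) *: q].
Proof.
have [->|qp] := eqVneq q p.
  by exists 1; rewrite ?lexx ?ler01//; apply: Or31; rewrite scale1r subrr scale0r addr0.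
move=> /cross_parallel[|a aE]; first by rewrite subr_eq0.
have rE : r = (1 - a) *: p + a *: q.
  by rewrite -[r](subrK p) aE; apply: rV2P; rewrite !mxE; ring.
have [a0|a0] := leP a 0.
  exists (- a / (1 - a)); first by rewrite divr_ge0 ?ler_pdivrMr; lra.
  have a1 : 1 - a != 0 by apply/eqP; lra.
  by apply: Or31; rewrite rE; apply: rV2P; rewrite !mxE; field.
have [a1|a1] := leP a 1.
  by exists (1 - a); [apply/andP; split; lra|apply: Or33; rewrite rE subKr].
exists ((a - 1) / a); first by rewrite divr_ge0 ?ler_pdivrMr; lra.
have an0 : a != 0 by apply/eqP; lra.
by apply: Or32; rewrite rE; apply: rV2P; rewrite !mxE; field.
Qed.

Definition others p L := [seq q <- L | q != p].

Lemma hull_others p L : p \in L -> hull L = hull (p :: others p L).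
Proof.
move=> pL; apply/seteqP; split; apply: hull_mono => x; rewrite ?inE.
  by move=> xL; apply: mem_hull; rewrite inE mem_filter xL andbT orbN.
by move=> /predU1P[->|]; [exact: mem_hull | rewrite mem_filter => /andP[_]; exact: mem_hull].
Qed.

(** A point of the hull on the line through [p] and [q] but beyond [p] would put [p]
between that point and [q], against extremality of [p]. *)
Lemma extreme_chord p q L z : p \in L -> q \in L -> p != q ->
  ~ hull (others p L) p -> hull L z -> (exists2 t : R, t < 0 & z = p + t *: (q - p)) -> False.
Proof.
move=> pL qL pq pext + [t t0 zE]; rewrite (hull_others pL) => /hull_cons[zp|].
  have /eqP : t *: (q - p) = 0 by apply: (addrI p); rewrite -zE zp addr0.
  rewrite scaler_eq0 subr_eq0 [q == p]eq_sym (negPf pq) orbF => /eqP t_eq0.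
  by move: t0; rewrite t_eq0 ltxx.
case=> s /andP[s0 s1] [y Ly]; rewrite zE => pyE; apply: pext.
have qL' : hull (others p L) q by apply: mem_hull; rewrite mem_filter eq_sym pq.
have st : s - t != 0 by apply/eqP; lra.
have comboE : p = (s / (s - t)) *: y + (1 - s / (s - t)) *: q.
  apply: rV2P; move/rowP: pyE => pyE; [have := pyE 0|have := pyE 1]; rewrite !mxE => E.
    have pE : (s - t) * p 0 0 = s * y 0 0 - t * q 0 0 by lra.
    by apply: (mulfI st); rewrite pE; field.
  have pE : (s - t) * p 0 1 = s * y 0 1 - t * q 0 1 by lra.
  by apply: (mulfI st); rewrite pE; field.
rewrite [X in hull _ X]comboE.
by apply: hull_convex => //; rewrite divr_ge0 ?ler_pdivrMr; lra.
Qed.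

Lemma chord_segment p q L z : p \in L -> q \in L -> p != q ->
  ~ hull (others p L) p -> ~ hull (others q L) q ->
  hull L z -> cross (q - p) (z - p) = 0 -> hull [:: p; q] z.
Proof.
move=> pL qL pq pext qext Lz /cross_parallel[|t tE]; first by rewrite subr_eq0 eq_sym.
have zE : z = p + t *: (q - p) by rewrite -tE addrC subrK.
have [t0|t0] := ltP t 0.
  by case: (extreme_chord pL qL pq pext Lz); exists t.
have [t1|t1] := ltP 1 t.
  have qp : q != p by rewrite eq_sym.
  case: (extreme_chord qL pL qp qext Lz); exists (1 - t); first by lra.
  by rewrite zE; apply: rV2P; rewrite !mxE; ring.
have -> : z = (1 - t) *: p + (1 - (1 - t)) *: q.
  by rewrite zE; apply: rV2P; rewrite !mxE; ring.
apply: hull_convex; first by apply/andP; split; lra.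
  by apply: mem_hull; rewrite !inE eqxx.
by apply: mem_hull; rewrite !inE eqxx orbT.
Qed.

(** A segment that joins the two halves crosses the line inside the hull, hence by
[chord_segment] in a point of [[p, q]], which belongs to both halves. *)
Lemma chord_cut p q L : p \in L -> q \in L -> p != q ->
  ~ hull (others p L) p -> ~ hull (others q L) q ->
  hull L = hull [seq x <- L | 0 <= cross (q - p) (x - p)] `|`
           hull [seq x <- L | cross (q - p) (x - p) <= 0].
Proof.
move=> pL qL pq pext qext; pose phi x := cross (q - p) (x - p).
set Lp := [seq x <- L | 0 <= _]; set Ln := [seq x <- L | _ <= 0].
have phip : phi p = 0 by rewrite /phi /cross subrr !mxE; ring.
have phiq : phi q = 0 by rewrite /phi /cross; ring.
have LpL : hull Lp `<=` hull L.
  by apply: hull_mono => x; rewrite mem_filter => /andP[_]; exact: mem_hull.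
have LnL : hull Ln `<=` hull L.
  by apply: hull_mono => x; rewrite mem_filter => /andP[_]; exact: mem_hull.
have pos x : hull Lp x -> 0 <= phi x.
  move: x; apply: hull_min => [x y t /andP[t0 t1] x0 y0|x].
    by rewrite /phi cross_affine addr_ge0// mulr_ge0// subr_ge0.
  by rewrite mem_filter => /andP[].
have neg x : hull Ln x -> phi x <= 0.
  move: x; apply: hull_min => [x y t /andP[t0 t1] x0 y0|x].
    have tx : t * phi x <= 0 by exact: mulr_ge0_le0.
    have ty : (1 - t) * phi y <= 0 by apply: mulr_ge0_le0; rewrite ?subr_ge0.
    by rewrite /phi cross_affine -/(phi x) -/(phi y); lra.
  by rewrite mem_filter => /andP[].
have on_line z : hull L z -> phi z = 0 -> hull Lp z /\ hull Ln z.
  move=> Lz z0; have pqz := chord_segment pL qL pq pext qext Lz z0.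
  split; apply: hull_mono pqz => x; rewrite !inE => /orP[] /eqP ->; apply: mem_hull;
    by rewrite mem_filter -/(phi _) ?phip ?phiq ?lexx.
apply/seteqP; split; last by move=> x [/LpL|/LnL].
have mixed a b t : 0 <= t <= 1 -> hull Lp a -> hull Ln b ->
    (hull Lp `|` hull Ln) (t *: a + (1 - t) *: b).
  move=> t01 La Lb; have a0 := pos _ La; have b0 := neg _ Lb.
  set z := _ + _; have Lz : hull L z by apply: hull_convex => //; [exact: LpL|exact: LnL].
  have phiz : phi z = t * phi a + (1 - t) * phi b by exact: cross_affine.
  have [ab0|ab0] := eqVneq (phi a - phi b) 0.
    have [pa pb] : phi a = 0 /\ phi b = 0 by split; lra.
    by left; have [] := on_line z Lz; rewrite // phiz pa pb; ring.
  pose t0 := - phi b / (phi a - phi b).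
  have ab : 0 < phi a - phi b by rewrite lt_def ab0 subr_ge0 (le_trans b0).
  have t0_itv : 0 <= t0 <= 1 by rewrite /t0 divr_ge0 ?ler_pdivrMr; lra.
  pose w := t0 *: a + (1 - t0) *: b.
  have [wp wn] : hull Lp w /\ hull Ln w.
    apply: on_line; first by apply: hull_convex => //; [exact: LpL|exact: LnL].
    by rewrite /phi cross_affine -/(phi a) -/(phi b) /t0; field.
  case/andP: (t01) => t_ge0 t_le1; case/andP: (t0_itv) => t0_ge0 t0_le1.
  have [tt0|tt0] := leP t0 t.
    left; have [t01'|t01'] := eqVneq (1 - t0) 0.
      have t1 : t = 1 by lra.
      by rewrite /z t1 scale1r subrr scale0r addr0.
    have -> : z = ((t - t0) / (1 - t0)) *: a + (1 - (t - t0) / (1 - t0)) *: w.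
      by rewrite /z /w; apply: rV2P; rewrite !mxE; field.
    by apply: hull_convex => //; rewrite divr_ge0 ?ler_pdivrMr; lra.
  right; have t0n : t0 != 0 by apply/eqP; lra.
  have -> : z = (t / t0) *: w + (1 - t / t0) *: b.
    by rewrite /z /w; apply: rV2P; rewrite !mxE; field.
  by apply: hull_convex => //; rewrite divr_ge0 ?ler_pdivrMr; lra.
apply: hull_min => [x y t t01 [xp|xn] [yp|yn]|x xL].
- by left; exact: hull_convex.
- exact: mixed.
- rewrite addrC -{2}[t](subKr 1); apply: mixed => //.
  by move: t01 => /andP[? ?]; apply/andP; split; lra.
- by right; exact: hull_convex.
have [x0|x0] := leP 0 (phi x); [left|right]; apply: mem_hull; rewrite mem_filter xL andbT//.
exact: ltW.
Qed.

End plane.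

(** * Polygons together with their opposites *)

Section polygons.
Context {R : realType}.
Local Notation V := 'rV[R]_2.
Local Notation index := (int * 'rV[int]_2)%type.
Variable alpha : V.
Local Notation orbit := (orbit alpha).
Local Notation visits := (visits alpha).
Local Notation generic := (generic alpha).
Local Notation steady := (steady alpha).
Local Notation G := (rotation_group alpha).
Implicit Types (A B C S : set V) (L : seq V) (x y z p q a b c u : V).

Lemma genericN y : generic y -> generic (- y).
Proof.
move=> gy J l Jfull; rewrite -eqmx_opp opprD opprK -orbitN; exact: gy.
Qed.

Lemma generic_line z p u : generic z -> G p -> G u -> u != 0 -> cross u (z - p) != 0.
Proof.
move=> gz /rotation_groupP[lp pE] /rotation_groupP[lu uE] u0.
apply/negP => /eqP/(cross_parallel u0)[t zp].
have not_full : ~~ row_full (span_of alpha [:: lu]).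
  have sub : (span_of alpha [:: lu] <= orbit lu)%MS by rewrite /= addsmx_sub submx_refl sub0mx.
  have := leq_trans (mxrankS sub) (rank_leq_row _).
  by rewrite /row_full; case: (\rank _) => [|[|]].
have /negP[] := gz _ (- lp) not_full.
rewrite orbitN -pE zp /= uE; apply: submx_trans (addsmxSl _ _).
exact: scalemx_sub.
Qed.

Lemma generic_point z p : generic z -> G p -> z != p.
Proof.
move=> gz /rotation_groupP[lp pE]; apply/negP => /eqP zp.
have not_full : ~~ row_full (span_of alpha [::]) by rewrite /row_full /= mxrank0.
by have := gz _ (- lp) not_full; rewrite orbitN -pE zp subrr sub0mx.
Qed.

(** The reflection at the origin: for sets symmetric about another point it is a
translate of the set. *)
Definition opposite A : set V := [set x | A (- x)].

Definition sym_visits A n y := (visits A n y + visits (opposite A) n y)%N.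

Lemma bounded_by_opposite r A : bounded_by r A -> bounded_by r (opposite A).
Proof. by move=> Ar x /Ar; rewrite normrN. Qed.

Lemma sym_visits_union r s A B C : bounded_by r B -> bounded_by s C ->
  (forall z, generic z -> A z <-> B z \/ C z) ->
  (forall z, generic z -> B z -> C z -> False) ->
  steady (sym_visits B) -> steady (sym_visits C) -> steady (sym_visits A).
Proof.
move=> Br Cs ABC BC0 /steadyD /[apply]; apply: eq_steady => n y gy.
have [K [tB tC tB' tC']] : exists K,
    [/\ thin K B, thin K C, thin K (opposite B) & thin K (opposite C)].
  have Bm : bounded_by (Num.max r s) B by move=> x /Br xr; rewrite le_max xr.
  have Cm : bounded_by (Num.max r s) C by move=> x /Cs xs; rewrite le_max xs orbT.
  have [K Kb] := slice_bound (d := 1) (Num.max r s).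
  exists K; split; apply: Kb => //; exact: bounded_by_opposite.
rewrite /sym_visits addnACA (visitsU n gy tB tC ABC BC0).
congr (_ + _)%N; apply: (visitsU n gy tB' tC').
  by move=> z /genericN/ABC.
by move=> z /genericN; exact: BC0.
Qed.

Lemma sym_visits_avoided A : (forall z, generic z -> ~ A z) -> steady (sym_visits A).
Proof.
move=> A0; apply: steadyD; first exact: steady_avoided.
by apply: steady_avoided => z /genericN; exact: A0.
Qed.

Lemma hull_bounded L : exists r, bounded_by r (hull L).
Proof. exact/bounded_set_by/compact_bounded/hull_compact. Qed.

(** The two quotients are the barycentric coordinates of [z] with respect to [b] and
[c], by Cramer's rule. *)
Lemma triangle_coords a b c z : cross (b - a) (c - a) != 0 ->
  hull [:: a; b; c] z <->
  [/\ 0 <= cross (z - a) (c - a) / cross (b - a) (c - a),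
      0 <= cross (b - a) (z - a) / cross (b - a) (c - a) &
      cross (z - a) (c - a) / cross (b - a) (c - a) +
      cross (b - a) (z - a) / cross (b - a) (c - a) <= 1].
Proof.
move=> D0; pose D := cross (b - a) (c - a).
pose s z := cross (z - a) (c - a) / D; pose t z := cross (b - a) (z - a) / D.
rewrite -/D -/(s z) -/(t z); split.
  move: z; apply: hull_min => [x y w /andP[w0 w1] [sx tx stx] [sy ty sty]|x].
    have -> : s (w *: x + (1 - w) *: y) = w * s x + (1 - w) * s y.
      by rewrite /s /cross !mxE; field.
    have -> : t (w *: x + (1 - w) *: y) = w * t x + (1 - w) * t y.
      by rewrite /t /cross !mxE; field.
    by split; nra.
  have sa : s a = 0 by rewrite /s /cross !mxE; field.
  have ta : t a = 0 by rewrite /t /cross !mxE; field.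
  have sb : s b = 1 by rewrite /s divff.
  have tb : t b = 0 by rewrite /t /cross !mxE; field.
  have sc : s c = 0 by rewrite /s /cross !mxE; field.
  have tc : t c = 1 by rewrite /t divff.
  by rewrite !inE => /or3P[] /eqP ->; rewrite ?sa ?ta ?sb ?tb ?sc ?tc; split; lra.
move=> [s0 t0 st]; have zE : z = a + (s z *: (b - a) + t z *: (c - a)).
  by rewrite -(cross_coords (z - a) D0) addrC subrK.
have [t1|t1] := eqVneq (t z) 1.
  have sz : s z = 0 by lra.
  rewrite zE t1 sz scale0r add0r scale1r addrC subrK.
  by apply: mem_hull; rewrite !inE eqxx !orbT.
have t1' : 1 - t z != 0 by rewrite subr_eq0 eq_sym.
have -> : z = t z *: c + (1 - t z) *:
    ((s z / (1 - t z)) *: b + (1 - s z / (1 - t z)) *: a).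
  rewrite {1}zE; move: (s z) (t z) t1' => S T T1.
  by apply: rV2P; rewrite !mxE; field.
have t_lt1 : 0 < 1 - t z by rewrite lt_def t1' /=; lra.
apply: hull_convex; first by apply/andP; split; lra.
  by apply: mem_hull; rewrite !inE eqxx !orbT.
apply: hull_convex.
    by rewrite divr_ge0 ?(ltW t_lt1)// ler_pdivrMr// mul1r; lra.
  by apply: mem_hull; rewrite !inE eqxx !orbT.
by apply: mem_hull; rewrite !inE eqxx.
Qed.

(** The parallelogram on the sides [b - a] and [c - a] is the union of the triangle and
of its opposite translated by [b + c], and these meet only on the line through [b]
and [c], which generic points avoid.  A degenerate triangle is avoided
altogether. *)
Lemma triangle_steady a b c : G a -> G b -> G c ->
  steady (sym_visits (hull [:: a; b; c])).
Proof.
move=> Ga Gb Gc; have [D0|D0] := eqVneq (cross (b - a) (c - a)) 0.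
  apply: sym_visits_avoided => z gz zabc.
  have line u : G u -> u != 0 -> (forall x, x \in [:: a; b; c] -> cross u (x - a) = 0) -> False.
    move=> Gu u0 abc; have /negP[] := generic_line gz Ga Gu u0; apply/eqP.
    move: z zabc {gz}; apply: hull_min => [x y t _ x0 y0|]; last exact: abc.
    by rewrite cross_affine x0 y0 !mulr0 addr0.
  have crossaa u : cross u (a - a) = 0 by rewrite /cross !mxE; ring.
  have crossuu u : cross u u = 0 by rewrite /cross; ring.
  have [ba|ba] := eqVneq b a; last first.
    apply: (line (b - a)); rewrite ?subr_eq0//; first exact: rotation_groupB.
    by move=> x; rewrite !inE => /or3P[] /eqP ->.
  have [ca|ca] := eqVneq c a; last first.
    apply: (line (c - a)); rewrite ?subr_eq0//; first exact: rotation_groupB.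
    by move=> x; rewrite !inE ba => /or3P[] /eqP ->.
  have /negP[] := generic_point gz Ga; apply/eqP.
  move: z zabc {gz}; apply: hull_min => [x y t _ -> ->|x].
    by rewrite -scalerDl addrC subrK scale1r.
  by rewrite ba ca !inE !orbb => /eqP.
set T := hull _; have [r Tr] := hull_bounded [:: a; b; c].
pose D := cross (b - a) (c - a).
pose s z := cross (z - a) (c - a) / D; pose t z := cross (b - a) (z - a) / D.
have TE z : T z <-> [/\ 0 <= s z, 0 <= t z & s z + t z <= 1] by exact: triangle_coords.
have /rotation_groupP[l lE] := rotation_groupD Gb Gc.
pose T' := translate (opposite T) (orbit l).
have T'E z : T' z <-> [/\ s z <= 1, t z <= 1 & 1 <= s z + t z].
  have sE : s (b + c - z) = 1 - s z.
    by rewrite /s /cross !mxE /D /cross !mxE; rewrite /cross !mxE in D0; field.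
  have tE : t (b + c - z) = 1 - t z.
    by rewrite /t /cross !mxE /D /cross !mxE; rewrite /cross !mxE in D0; field.
  rewrite /T' /translate/opposite/= opprB -lE TE sE tE.
  by split=> -[? ? ?]; split; lra.
have [K tT] := bounded_thin Tr; have [K' tT'] := bounded_thin (bounded_by_opposite Tr).
have [Ls LsE] : exists Ls, [:: b - a; c - a] = map orbit Ls.
  apply: (@rotation_group_seq _ _ alpha) => v.
  by rewrite !inE => /orP[] /eqP ->; exact: rotation_groupB.
have /rotation_groupP[la laE] := Ga.
have := zono_steady alpha Ls la; rewrite -LsE -laE; set P := translate _ a => Psteady.
have PE z : P z <-> [/\ 0 <= s z, s z <= 1, 0 <= t z & t z <= 1].
  rewrite /P /translate/=; split.
    case=> p /andP[p0 p1] [q /andP[q0 q1]] /eqP; rewrite subr_eq0 subr_eq => /eqP zE.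
    have zE' : z = a + (q *: (c - a) + p *: (b - a)) by rewrite -zE addrC subrK.
    have -> : s z = p by rewrite /s zE' /D /cross !mxE; rewrite /cross !mxE in D0; field.
    have -> : t z = q by rewrite /t zE' /D /cross !mxE; rewrite /cross !mxE in D0; field.
    by [].
  case=> s0 s1 t0 t1; exists (s z); first by rewrite s0.
  exists (t z); first by rewrite t0.
  by rewrite {1}(cross_coords (z - a) D0) -/D -/(s z) -/(t z) addrAC addrK subrr.
have bigK : exists K, thin K T /\ thin K T'.
  exists (maxn K K'); split=> x.
    by have [? sK] := tT x; split=> //; rewrite leq_max sK.
  have -> : slice T' x = slice (opposite T) (x - orbit l).
    by apply/funext => m; rewrite /slice/T'/translate/= addrAC.
  by have [? sK] := tT' (x - orbit l); split=> //; rewrite leq_max sK orbT.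
have [K2 [tT2 tT'2]] := bigK.
have TT' : steady (fun n y => visits T n y + visits T' n y)%N.
  apply: eq_steady Psteady => n y gy; apply/esym/(visitsU n gy tT2 tT'2).
    move=> z gz; rewrite PE TE T'E; split=> [[? ? ? ?]|[[? ? ?]|[? ? ?]]].
    - by have [?|?] := leP (s z + t z) 1; [left|right]; split=> //; lra.
    - by split=> //; lra.
    - by split=> //; lra.
  move=> z gz /TE[_ _ le1] /T'E[_ _ ge1].
  have bc : c - b != 0.
    by apply: contra D0; rewrite subr_eq0 => /eqP ->; rewrite /cross; apply/eqP; ring.
  have /negP[] := generic_line gz Gb (rotation_groupB Gc Gb) bc; apply/eqP.
  have st1 : s z + t z = 1 by lra.
  have : (s z + t z) * D = D by rewrite st1 mul1r.
  by rewrite mulrDl /s /t !divfK// /D /cross !mxE; lra.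
apply: (@steady_close _ _ _ (`|l.1| * K').*2) TT' => n y _.
have [le1 le2] := visits_shift alpha l n y tT'; rewrite -/T' in le1 le2.
by rewrite /sym_visits -!addnA !leq_add2l.
Qed.

Lemma size_filter_lt (T : eqType) (P : pred T) (s : seq T) (x : T) :
  x \in s -> ~~ P x -> (size [seq y <- s | P y] < size s)%N.
Proof.
move=> xs Px; rewrite size_filter -(count_predC P s) -[ltnLHS]addn0 ltn_add2l -has_count.
by apply/hasP; exists x.
Qed.

(** A chord with points strictly on both sides leaves strictly fewer points in each
half. *)
Lemma chord_steady L p q r s : (forall x, x \in L -> G x) ->
  (forall L', (size L' < size L)%N -> (forall x, x \in L' -> G x) ->
     steady (sym_visits (hull L'))) ->
  (forall x, x \in L -> ~ hull (others x L) x) ->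
  [/\ p \in L, q \in L, r \in L & s \in L] -> p != q ->
  0 < cross (q - p) (r - p) -> cross (q - p) (s - p) < 0 ->
  steady (sym_visits (hull L)).
Proof.
move=> LG IH ext [pL qL rL sL] pq r0 s0.
have [a Ba] := hull_bounded [seq x <- L | 0 <= cross (q - p) (x - p)].
have [b Cb] := hull_bounded [seq x <- L | cross (q - p) (x - p) <= 0].
apply: (sym_visits_union Ba Cb).
- by move=> z _; rewrite (chord_cut pL qL pq (ext _ pL) (ext _ qL)).
- move=> z gz zp zn; have qp : q - p != 0 by rewrite subr_eq0 eq_sym.
  have /negP[] := generic_line gz (LG _ pL) (rotation_groupB (LG _ qL) (LG _ pL)) qp.
  rewrite eq_le; apply/andP; split.
    move: z zn {gz zp}; apply: hull_min => [x y t /andP[t0 t1] x0 y0|x].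
      have tx := mulr_ge0_le0 t0 x0.
      have ty : (1 - t) * cross (q - p) (y - p) <= 0 by rewrite mulr_ge0_le0// subr_ge0.
      by rewrite cross_affine; lra.
    by rewrite mem_filter => /andP[].
  move: z zp {gz zn}; apply: hull_min => [x y t /andP[t0 t1] x0 y0|x].
    by rewrite cross_affine addr_ge0// mulr_ge0// subr_ge0.
  by rewrite mem_filter => /andP[].
- apply: IH => [|x]; last by rewrite mem_filter => /andP[_ /LG].
  by apply: (size_filter_lt sL); rewrite -ltNge.
- apply: IH => [|x]; last by rewrite mem_filter => /andP[_ /LG].
  by apply: (size_filter_lt rL); rewrite -ltNge.
Qed.

(** Points in the hull of the others are dropped first.  Among four of the remaining
points [p], [a], [b], [c] no three are collinear, so the cross products [A], [B],
[C] of the vectors from [p] are nonzero and two of them have the same sign; the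
chord from [p] to the point that both of these involve then separates the two
other points. *)
Lemma sym_hull_steady L : (forall p, p \in L -> G p) -> steady (sym_visits (hull L)).
Proof.
have [k] := ubnP (size L); elim: k L => // k IHk L; rewrite ltnS => Lk LG.
have IH L' : (size L' < size L)%N -> (forall x, x \in L' -> G x) ->
    steady (sym_visits (hull L')).
  by move=> L'L; apply: IHk; exact: leq_trans L'L Lk.
have [uL|nuL] := boolP (uniq L); last first.
  have -> : hull L = hull (undup L).
    apply/seteqP; split; apply: hull_mono => x xL; apply: mem_hull; move: xL;
      by rewrite mem_undup.
  apply: IH => [|x]; last by rewrite mem_undup; exact: LG.
  by rewrite ltn_size_undup.
have [[x xL xhull]|ext'] := pselect (exists2 x, x \in L & hull (others x L) x).
  have -> : hull L = hull (others x L).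
    rewrite (hull_others xL); apply/seteqP; split; apply: hull_mono => y; rewrite ?inE.
      by move=> /predU1P[->|]; [exact: xhull|exact: mem_hull].
    by move=> yL; apply: mem_hull; rewrite inE yL orbT.
  apply: IH => [|y]; last by rewrite mem_filter => /andP[_ /LG].
  by apply: (size_filter_lt xL); rewrite negbK.
have ext x : x \in L -> ~ hull (others x L) x by move=> xL xh; apply: ext'; exists x.
have no_mix x y z (t : R) : x \in L -> y \in L -> z \in L -> y != x -> z != x ->
    0 <= t <= 1 -> x <> t *: y + (1 - t) *: z.
  move=> xL yL zL yx zx t01 xE; apply: (ext x xL); rewrite [X in hull _ X]xE.
  by apply: hull_convex => //; apply: mem_hull; rewrite mem_filter ?yx ?zx.
have triangle_of L' a b c : (forall x, (x \in L') = (x \in [:: a; b; c])) ->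
    (forall x, x \in L' -> G x) -> steady (sym_visits (hull L')).
  move=> L'E L'G; have -> : hull L' = hull [:: a; b; c].
    by apply/seteqP; split; apply: hull_mono => x xL; apply: mem_hull; rewrite ?L'E// -L'E.
  by apply: triangle_steady; apply: L'G; rewrite L'E !inE eqxx ?orbT.
case: L => [|p [|a [|b [|c L]]]] in Lk LG IH uL ext no_mix {ext'} *.
- by apply: sym_visits_avoided => z _; rewrite hull_nil.
- by apply: (triangle_of _ p p p) => // x; rewrite !inE !orbb.
- by apply: (triangle_of _ p a a) => // x; rewrite !inE !orbb.
- exact: (triangle_of _ p a b).
have [pL aL bL cL] : [/\ p \in [:: p, a, b, c & L], a \in [:: p, a, b, c & L],
  b \in [:: p, a, b, c & L] & c \in [:: p, a, b, c & L]] by rewrite !inE !eqxx !orbT.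
have [pa pb pc [ab ac bc]] : [/\ p != a, p != b, p != c & [/\ a != b, a != c & b != c]].
  move: uL; rewrite /= !inE !negb_or.
  by move=> /and4P[/and4P[-> -> -> _] /and3P[-> -> _] /andP[-> _] _].
have noncollinear x y z : x \in [:: p, a, b, c & L] -> y \in [:: p, a, b, c & L] ->
    z \in [:: p, a, b, c & L] -> x != y -> x != z -> y != z ->
    cross (y - x) (z - x) != 0.
  move=> xL yL zL xy xz yz; apply/negP => /eqP/cross_collinear[t t01 []].
  - by apply: no_mix => //; rewrite eq_sym.
  - by apply: no_mix => //; rewrite eq_sym.
  - exact: no_mix.
pose A := cross (b - p) (c - p); pose B := cross (c - p) (a - p); pose C := cross (a - p) (b - p).
have anti u v : cross u v = - cross v u by rewrite /cross; ring.
have A0 : A != 0 by apply: noncollinear.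
have B0 : B != 0 by apply: noncollinear => //; rewrite eq_sym.
have C0 : C != 0 by apply: noncollinear.
have cut := @chord_steady _ _ _ _ _ LG IH ext.
have [Apos|Aneg] : 0 < A \/ A < 0 by move: A0; rewrite neq_lt => /orP[]; auto.
  have [Bpos|Bneg] : 0 < B \/ B < 0 by move: B0; rewrite neq_lt => /orP[]; auto.
    by apply: (cut p c a b); rewrite // [X in X < 0]anti oppr_lt0.
  have [Cpos|Cneg] : 0 < C \/ C < 0 by move: C0; rewrite neq_lt => /orP[]; auto.
    by apply: (cut p b c a); rewrite // [X in X < 0]anti oppr_lt0.
  by apply: (cut p a c b); rewrite // [X in 0 < X]anti oppr_gt0.
have [Bpos|Bneg] : 0 < B \/ B < 0 by move: B0; rewrite neq_lt => /orP[]; auto.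
  have [Cpos|Cneg] : 0 < C \/ C < 0 by move: C0; rewrite neq_lt => /orP[]; auto.
    by apply: (cut p a b c); rewrite // [X in X < 0]anti oppr_lt0.
  by apply: (cut p b a c); rewrite // [X in 0 < X]anti oppr_gt0.
by apply: (cut p c b a); rewrite // [X in 0 < X]anti oppr_gt0.
Qed.

End polygons.

(** * Centrally symmetric polygons *)

Section symmetric_polygons.
Context {R : realType}.
Local Notation V := 'rV[R]_2.
Variable alpha : V.
Local Notation orbit := (orbit alpha).
Local Notation visits := (visits alpha).
Local Notation steady := (steady alpha).
Local Notation G := (rotation_group alpha).
Implicit Types (S : set V) (L : seq V) (x y z p c : V).

(** If a point of a proper segment of the hull, written with [hull_cons] as a mixture
of [x] and of the hull of the others, equals [x], then solving for [x] puts [x]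
in the hull of the others unless both end points are [x]. *)
Lemma extreme_vertex L x : x \in L -> ~ hull (others x L) x -> vertices (hull L) x.
Proof.
move=> xL ext; split; first exact: mem_hull.
rewrite (hull_others xL) => y z t /hull_cons yh /hull_cons zh t0 t1 xE.
have t1n : 1 - t != 0 by apply/eqP; lra.
have tn : t != 0 by apply/eqP; lra.
case: yh zh => [yx|[a /andP[a0 a1] [y' Ly' yE]]].
  move=> _; split=> //; apply: (scalerI t1n).
  by apply: (addrI (t *: x)); rewrite -{1}yx -xE -scalerDl addrC subrK scale1r.
case=> [zx|[b /andP[b0 b1] [z' Lz' zE]]].
  split=> //; apply: (scalerI tn); apply: (addIr ((1 - t) *: x)).
  by rewrite -{1}zx -xE -scalerDl [t + _]addrC subrK scale1r.
pose w := t * a + (1 - t) * b.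
have ta0 : 0 <= t * a by rewrite mulr_ge0// ltW.
have tb0 : 0 <= (1 - t) * b by rewrite mulr_ge0// subr_ge0 ltW.
have wE : w *: x = (t * a) *: y' + ((1 - t) * b) *: z'.
  move/rowP: xE; rewrite yE zE => xE; apply/rowP => i; have := xE i.
  by rewrite !mxE /w => E; lra.
have [w0|w0] := eqVneq w 0.
  have [a_eq0 b_eq0] : a = 0 /\ b = 0.
    have /eqP : t * a = 0 by rewrite /w in w0; lra.
    have /eqP : (1 - t) * b = 0 by rewrite /w in w0; lra.
    by rewrite !mulf_eq0 (negPf t1n) (negPf tn) => /eqP -> /eqP ->.
  by rewrite yE zE a_eq0 b_eq0 subr0 !scale1r !scale0r !addr0.
case: ext.
have xE' : x = (t * a / w) *: y' + (1 - t * a / w) *: z'.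
  apply: (scalerI w0); rewrite wE scalerDr !scalerA mulrBr mulr1 [w * _]mulrC divfK//.
  by congr (_ + _ *: _); rewrite /w; ring.
rewrite [X in hull _ X]xE'; apply: hull_convex => //.
have w_gt0 : 0 < w by rewrite lt_def w0 addr_ge0.
by rewrite divr_ge0 ?(ltW w_gt0)//= ler_pdivrMr// mul1r /w; lra.
Qed.

(** A minimal set of points with the given hull consists of vertices. *)
Lemma hull_vertices L : exists2 L', hull L = hull L' &
  forall x, x \in L' -> vertices (hull L) x.
Proof.
have [k] := ubnP (size L); elim: k L => // k IH L; rewrite ltnS => Lk.
have [[x xL xhull]|ext] := pselect (exists2 x, x \in L & hull (others x L) x); last first.
  by exists L => // x xL; apply: extreme_vertex => // xh; apply: ext; exists x.
have -> : hull L = hull (others x L).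
  rewrite (hull_others xL); apply/seteqP; split; apply: hull_mono => y; rewrite ?inE.
    by move=> /predU1P[->|]; [exact: xhull|exact: mem_hull].
  by move=> yL; apply: mem_hull; rewrite inE yL orbT.
apply: IH; apply: leq_trans Lk.
by apply: (size_filter_lt xL); rewrite negbK.
Qed.

Lemma symmetric_vertex S c v : (forall x, S x -> S (c *+ 2 - x)) ->
  vertices S v -> vertices S (c *+ 2 - v).
Proof.
move=> Sc [Sv vext]; split=> [|x y t Sx Sy t0 t1 vE]; first exact: Sc.
have [] := vext (c *+ 2 - x) (c *+ 2 - y) t (Sc _ Sx) (Sc _ Sy) t0 t1.
  have -> : v = c *+ 2 - (t *: x + (1 - t) *: y) by rewrite -vE subKr.
  by apply/rowP => i; rewrite !mxE; ring.
by move=> xv yv; split; [rewrite -xv subKr | rewrite -yv subKr].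
Qed.

(** Twice the centre is the sum of two opposite vertices, hence in the group, so [-S]
is a translate of [S] by a vector of the group and has the same visits up to a
bounded error. *)
Lemma polygon_bounded_remainder S : convex_polygon S -> centrally_symmetric S ->
  vertices S `<=` G -> bounded_remainder_set alpha S.
Proof.
move=> [polyS [z /interior_subset So]] [c Sc] SG.
apply: polytope_bounded_remainder => //.
have [L0 SE0] := polytope_hull polyS; have [L L0E Lvert] := hull_vertices L0.
have SE : S = hull L by rewrite SE0.
rewrite -SE0 in Lvert.
have LG x : x \in L -> G x by move=> /Lvert/SG.
have [v vL] : exists v, v \in L.
  case: (L) SE => [SE|v L' _]; last by exists v; rewrite mem_head.
  by move: So; rewrite SE hull_nil.
have Gc : G (c *+ 2).
  rewrite -[c *+ 2](subrK v); apply: rotation_groupD; last exact: LG.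
  by apply: SG; apply: symmetric_vertex => //; exact: Lvert.
have /rotation_groupP[l lE] := Gc.
have oppE : opposite S = translate S (orbit (- l)).
  apply/funext => x; apply/propext; rewrite /opposite/translate/= orbitN -lE opprK.
  split=> [/Sc|/Sc]; first by rewrite opprK addrC.
  by rewrite opprD addrCA subrr addr0.
have [r Sr] := hull_bounded L; rewrite -SE in Sr; have [K tS] := bounded_thin Sr.
apply: steady_half.
have := sym_hull_steady LG; rewrite -SE.
apply: (@steady_close _ _ _ (`|(- l).1| * K).*2) => n y _.
have [le1 le2] := visits_shift alpha (- l) n y tS.
by rewrite /sym_visits oppE -!addnA !leq_add2l.
Qed.

End symmetric_polygons.

Theorem corollary1 (R : realType) :
  (forall (alpha : 'rV[R]_2) (S : set 'rV[R]_2),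
     irrational_vector alpha ->
     convex_polygon S -> centrally_symmetric S ->
     vertices S `<=` rotation_group alpha ->
     bounded_remainder_set alpha S)
  /\
  (forall (d : nat) (alpha : 'rV[R]_d.+1) (S : set 'rV[R]_d.+1),
     irrational_vector alpha ->
     zonotope S ->
     vertices S `<=` rotation_group alpha ->
     bounded_remainder_set alpha S).
Proof.
split=> [alpha S _|d alpha S _].
  exact: polygon_bounded_remainder.
exact: zonotope_bounded_remainder.
Qed.
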